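(* There exist an operator $V$, acting as a bounded linear operator on every $\ell^p(\mathbb Z)$, $1\le p\le\infty$, and a constant $C\ge1$ such that $V$ is strongly Kreiss bounded on $\ell^p(\mathbb Z)$ for every $1\le p\le\infty$ and $$C^{-1}N^{|1/2-1/p|}\le \|V^N\|_{B(\ell^p(\mathbb Z))}\le C\,N^{|1/2-1/p|}$$ for all $1\le p\le\infty$ and all integers $N\ge1$ (with $1/\infty=0$).
   Context: Banach spaces are complex, and $B(X)$ denotes the space of bounded linear operators on a Banach space $X$. A bounded linear operator $T$ on $X$ is called strongly Kreiss bounded if $\sigma(T)\subset\overline{\mathbb D}$ (the closed unit disk) and there is $C>0$ such that $\|(\lambda-T)^{-k}\|\le \frac{C}{(|\lambda|-1)^k}$ for all $\lambda\in\mathbb C$ with $|\lambda|>1$ and all integers $k\ge1$. That $V$ acts on every $\ell^p(\mathbb Z)$ means that $V$ is a bounded linear operator on $\ell^\infty(\mathbb Z)$ whose restriction to each $\ell^p(\mathbb Z)$ is a bounded operator from $\ell^p(\mathbb Z)$ to itself. *)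

(* Defs.v *)
From HB Require Import structures.
From mathcomp Require Import all_boot all_order all_algebra.
From mathcomp Require Import complex.
From mathcomp Require Import all_classical all_reals all_analysis ess_sup_inf.

Set Implicit Arguments.
Unset Strict Implicit.
Unset Printing Implicit Defensive.

Import Order.TTheory GRing.Theory Num.Theory.
Import numFieldNormedType.Exports.
Import ComplexField.Normc.

Local Open Scope classical_set_scope.
Local Open Scope ring_scope.

HB.instance Definition _ := isPointed.Build int 0.
HB.instance Definition _ := @isMeasurable.Build default_measure_display
  int discrete_measurable discrete_measurable0
  discrete_measurableC discrete_measurableU.

Section ellnorm.
Variable R : realType.
Implicit Types (x y : int -> R[i]) (p : \bar R).

Lemma normc_normr (z : R[i]) : (normc z)%:C%C = `|z|.
Proof. by rewrite normc_def; case: z. Qed.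

Lemma normc_ge0 (z : R[i]) : 0 <= normc z.
Proof. by rewrite -lecR normc_normr /= normr_ge0. Qed.

(* For the counting measure the L^p norm is the l^p norm, p = +oo included: see
   ellnorm_fin and ellnorm_infty. *)
Definition ellnorm p x : \bar R := 'N[counting]_p[(fun k => (normc (x k))%:E)].

Lemma ellnorm_ge0 p x : (0 <= ellnorm p x)%E.
Proof. exact: Lnorm_ge0. Qed.

Lemma counting1 (k : int) : counting [set k] = 1%E :> \bar R.
Proof. by rewrite /counting asboolT// fset_set1 finmap.cardfs1. Qed.

Lemma counting_ge1 (k : int) (A : set int) : A k -> (1 <= counting A :> \bar R)%E.
Proof.
by move=> Ak; rewrite -(counting1 k) le_measure// ?inE// => j ->.
Qed.

Lemma counting_gt0 : (0 < counting [set: int] :> \bar R)%E.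
Proof. exact: lt_le_trans (counting_ge1 (k := 0) _). Qed.

Lemma integral_counting1 (f : int -> \bar R) (k : int) :
  (\int[counting]_(j in [set k]) f j = f k)%E.
Proof.
rewrite (@eq_integral _ _ _ _ _ (cst (f k))); last first.
  by move=> j; rewrite inE /= => ->.
by rewrite integral_cst// -[RHS]mule1; congr (_ * _)%E; exact: counting1.
Qed.

Lemma integral_counting_int (f : int -> \bar R) : (forall k, 0 <= f k)%E ->
  (\int[counting]_k f k = \esum_(k in setT) f k)%E.
Proof.
move=> f0; pose F (n : nat) : set int := [set k : int | choice.pickle k = n].
have tF : trivIset setT F.
  by move=> i j _ _ [k [/= <- <-]].
have UF : \bigcup_n F n = setT.
  by apply/seteqP; split=> // k _; exists (choice.pickle k).
rewrite -UF ge0_integral_bigcup// nneseries_sum_bigcup//.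
apply: eq_eseriesr => n _.
have [[k Fk]|nF] := pselect (exists k, F n k).
  have -> : F n = [set k].
    apply/seteqP; split=> [j|j ->//]; rewrite /F /= => Fj.
    by apply: (pcan_inj choice.pickleK); rewrite Fj.
  by rewrite integral_counting1 esum_set1.
have -> : F n = set0 by apply/seteqP; split=> // k Fk; case: nF; exists k.
by rewrite integral_set0 esum_set0.
Qed.

Lemma ellnorm_fin (r : R) x :
  ellnorm r%:E x = ((\esum_(k in setT) (normc (x k) `^ r)%:E) `^ r^-1)%E.
Proof.
rewrite /ellnorm unlock integral_counting_int; last first.
  by move=> k; exact: poweR_ge0.
congr (_ `^ _)%E; apply: eq_esum => k _.
by rewrite gee0_abs ?lee_fin ?normc_ge0// poweR_EFin.
Qed.

Lemma ellnorm_infty x :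
  ellnorm +oo x = ereal_sup (range (fun k => (normc (x k))%:E)).
Proof.
rewrite /ellnorm unlock counting_gt0; apply/eqP; rewrite eq_le; apply/andP; split.
  apply/ess_supP/nearW => k /=; rewrite ger0_norm ?normc_ge0//.
  by apply: ereal_sup_ubound; exists k.
apply: ge_ereal_sup => _ [k _ <-].
have [A [mA A0 HA]] := ess_sup_ge counting (abse \o (fun k => (normc (x k))%:E)).
have [|kA] := pselect (A k); last first.
  have := contra_notP (HA k) kA; rewrite /= ger0_norm ?normc_ge0//.
by move=> /counting_ge1; rewrite A0 lee_fin ler10.
Qed.

Lemma ellnormD p x y : (1 <= p)%E ->
  (ellnorm p (x + y)%R <= ellnorm p x + ellnorm p y)%E.
Proof.
move=> p1; pose f k : R := normc (x k); pose g k : R := normc (y k).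
apply: le_trans (_ : 'N[counting]_p[EFin \o (f \+ g)%R] <= _)%E; last first.
  exact: eminkowski.
have fg k : normc ((x + y) k) <= (f \+ g) k by exact: le_normcD.
have fg0 k : 0 <= (f \+ g) k by rewrite addr_ge0 ?normc_ge0.
case: p p1 => [r r1||//]; rewrite /ellnorm unlock.
  have r0 : 0 < r by rewrite (lt_le_trans ltr01).
  apply: gt0_ler_poweR.
  - by rewrite invr_ge0 ltW.
  - by rewrite in_itv /= leey integral_ge0// => k _; exact: poweR_ge0.
  - by rewrite in_itv /= leey integral_ge0// => k _; exact: poweR_ge0.
  apply: ge0_le_integral => //; [by move=> *; exact: poweR_ge0..|].
  move=> k _; rewrite /= !ger0_norm ?normc_ge0 ?[0 <= _]fg0// lee_fin.
  by rewrite ge0_ler_powR ?nnegrE ?normc_ge0 ?[0 <= _]fg0 ?(ltW r0)//; exact: fg.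
case: ifP => // _ _; apply/le_ess_sup/nearW => k /=.
by rewrite !ger0_norm ?normc_ge0 ?[0 <= _]fg0// lee_fin; exact: fg.
Qed.

Lemma ellnormZ p (a : R[i]) x : (1 <= p)%E ->
  (ellnorm p (a *: x) = (normc a)%:E * ellnorm p x)%E.
Proof.
case: p => [r r1||//]; rewrite /ellnorm unlock.
  have r0 : 0 < r by rewrite (lt_le_trans ltr01).
  rewrite (@eq_integral _ _ _ _ _
    (fun k => ((normc a `^ r)%:E * (`|(normc (x k))%:E| `^ r))%E)); last first.
    move=> k _; rewrite normcM /= !ger0_norm ?mulr_ge0 ?normc_ge0//.
    by rewrite -EFinM powRM ?normc_ge0.
  rewrite ge0_integralZl ?lee_fin ?powR_ge0//; last first.
    by move=> *; exact: poweR_ge0.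
  rewrite poweRM ?lee_fin ?powR_ge0//; last first.
    by apply: integral_ge0 => *; exact: poweR_ge0.
  by rewrite poweR_EFin -powRrM mulfV ?gt_eqF// powRr1 ?normc_ge0.
case: ifP => [c0 _|_ _]; last by rewrite mule0.
rewrite -ess_supZl ?normc_ge0//; congr ess_sup; apply/funext => k /=.
by rewrite normcM normrM EFinM (ger0_norm (normc_ge0 a)).
Qed.

Lemma normc_le_ellnorm p x k : (1 <= p)%E -> ((normc (x k))%:E <= ellnorm p x)%E.
Proof.
case: p => [r r1||//].
  have r0 : 0 < r by rewrite (lt_le_trans ltr01).
  have xr0 j : (0 <= (normc (x j) `^ r)%:E)%E by rewrite lee_fin powR_ge0.
  rewrite ellnorm_fin.
  have -> : (normc (x k))%:E = ((normc (x k) `^ r)%:E `^ r^-1)%E.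
    by rewrite poweR_EFin -powRrM mulfV ?gt_eqF// powRr1 ?normc_ge0.
  apply: gt0_ler_poweR; rewrite ?in_itv /= ?leey ?andbT//.
  - by rewrite invr_ge0 ltW.
  - exact: esum_ge0.
  - apply: esum_ge; exists [set k]; first by split.
    by rewrite fsbig_set1.
by move=> _; rewrite ellnorm_infty; apply: ereal_sup_ubound; exists k.
Qed.

Lemma ellnorm_infty_le p x : (1 <= p)%E -> (ellnorm +oo x <= ellnorm p x)%E.
Proof.
move=> p1; rewrite ellnorm_infty; apply: ge_ereal_sup => _ [k _ <-].
exact: normc_le_ellnorm.
Qed.

Lemma ellnorm0 p : (1 <= p)%E -> ellnorm p 0 = 0%E.
Proof. by move=> p1; rewrite -(scale0r 0) ellnormZ// normc0 mul0e. Qed.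

End ellnorm.

Definition ell_pred (R : realType) (p : \bar R) : {pred int -> R[i]} :=
  mem [set x | (ellnorm p x < +oo)%E].

(* The proof p1 is a phantom parameter, so that the normed space structure below
   can be inferred from the type (as in LfunType). *)
Record ell (R : realType) (p : \bar R) (p1 : (1 <= p)%E) :=
  Ell { ell_val :> int -> R[i] ; _ : ell_val \in ell_pred p }.

Arguments ell R {p} p1.

Section ell.
Variables (R : realType) (p : \bar R) (p1 : (1 <= p)%E).
Local Notation ell := (ell R p1).

HB.instance Definition _ := [isSub of ell for @ell_val R p p1].
HB.instance Definition _ := [Choice of ell by <:].

Lemma ellP (x : ell) : (ellnorm p x < +oo)%E.
Proof. by have := valP x; rewrite inE. Qed.

Lemma ell_submod_closed : submod_closed (ell_pred p).
Proof.
split=> [|a x y]; rewrite !inE /=; first by rewrite ellnorm0.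
move=> xoo yoo; apply: le_lt_trans (ellnormD _ _ p1) _.
by rewrite lte_add_pinfty// ellnormZ// lte_mul_pinfty// lee_fin normc_ge0.
Qed.

HB.instance Definition _ :=
  GRing.isSubmodClosed.Build _ _ (ell_pred p) ell_submod_closed.
HB.instance Definition _ := [SubChoice_isSubLmodule of ell by <:].

Definition ell_norm (x : ell) : R[i] := (fine (ellnorm p x))%:C%C.

Lemma fine_ellnorm (x : ell) : (fine (ellnorm p x))%:E = ellnorm p x.
Proof. by rewrite fineK// ge0_fin_numE ?ellnorm_ge0// ellP. Qed.

Lemma ler_ell_normD (x y : ell) : ell_norm (x + y) <= ell_norm x + ell_norm y.
Proof.
by rewrite -rmorphD lecR -lee_fin EFinD !fine_ellnorm; exact: ellnormD.
Qed.

Lemma ell_normZ (a : R[i]) (x : ell) : ell_norm (a *: x) = `|a| * ell_norm x.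
Proof.
rewrite -normc_normr -rmorphM; congr (_%:C)%C; apply: EFin_inj.
by rewrite EFinM !fine_ellnorm; exact: ellnormZ.
Qed.

Lemma ell_norm_eq0 (x : ell) : ell_norm x = 0 -> x = 0.
Proof.
move=> /complexI x0; apply/val_inj/funext => k; apply: eq0_normc.
apply/eqP; rewrite eq_le normc_ge0 andbT -lee_fin.
by rewrite (le_trans (normc_le_ellnorm _ _ p1))// -fine_ellnorm x0.
Qed.

HB.instance Definition _ :=
  Lmodule_isNormed.Build R[i] ell ler_ell_normD ell_normZ ell_norm_eq0.

Lemma ell_normE (x : ell) : `|x| = (fine (ellnorm p x))%:C%C.
Proof. by []. Qed.

Lemma ell_valD (x y : ell) k : (x + y) k = x k + y k.
Proof. by []. Qed.

Lemma ell_valZ (a : R[i]) (x : ell) k : (a *: x) k = a * x k.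
Proof. by []. Qed.

End ell.

Definition ell_infty (R : realType) := ell R (leey 1).

Section ell_restriction.
Variables (R : realType) (p : \bar R) (p1 : (1 <= p)%E).

Lemma ell_incl_subproof (x : ell R p1) : (x : int -> R[i]) \in ell_pred +oo.
Proof.
by rewrite inE /=; apply: le_lt_trans (ellnorm_infty_le _ p1) (ellP x).
Qed.

Definition ell_incl (x : ell R p1) : ell_infty R := Ell (leey 1) (ell_incl_subproof x).

Definition is_restriction (V : ell_infty R -> ell_infty R)
    (W : ell R p1 -> ell R p1) :=
  forall x, ell_incl (W x) = V (ell_incl x).

End ell_restriction.

Section operators.
Variables (R : realType) (X : normedModType R[i]).
Implicit Types (T S : {linear X -> X}) (l : R[i]).

Definition bounded_operator T := exists M : R[i], forall x, `|T x| <= M * `|x|.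

(* The norm of R[i] takes its values in R[i] (on the real axis); Re brings
   them back to R. *)
Definition opnorm (T : X -> X) : \bar R :=
  ereal_sup [set (complex.Re `|T x|)%:E | x in [set x | `|x| <= 1]].

(* S = (l - T)^-1 in B(X) *)
Definition is_resolvent T l S :=
  [/\ bounded_operator S,
      forall x, S (l *: x - T x) = x &
      forall x, l *: S x - T (S x) = x].

Definition spectrum T : set R[i] := [set l | ~ exists S, is_resolvent T l S].

Definition strongly_kreiss_bounded T :=
  spectrum T `<=` [set l | `|l| <= 1] /\
  exists2 C : R, 0 < C &
    forall l S k, 1 < `|l| -> is_resolvent T l S -> (1 <= k)%N ->
      (opnorm (iter k S) <= (C / (normc l - 1) ^+ k)%:E)%E.

End operators.

(* Main.v *)
Require Import Defs.
From HB Require Import structures.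
From mathcomp Require Import all_boot all_order all_algebra.
From mathcomp Require Import complex.
From mathcomp Require Import all_classical all_reals all_analysis.
From mathcomp Require Import ring lra zify.

(* [V] is the Blaschke factor [b(s) = (s - 1/2) / (1 - s/2)] of the bilateral
   shift.  Everything is read off the Taylor coefficients [h j k] of
   [b(s)^j / (1 - s/2)], which are orthogonal sequences in [k] and satisfy
   three-term recurrences both in [j] and in [k].

   Strong Kreiss condition.  Writing [W = (1 + w V) / 2] with [|w| = 1], it is
   enough that [|W^n|] be bounded in the Wiener algebra uniformly in [n] and [w].
   The coefficients of [W^n] form a wave packet: orthogonality gives their l^2
   norm, of order [n^(-1/4)], the recurrence in [j] gives their first moment
   around the centre of the packet, of order [n^(1/4)], and the two together
   bound the l^1 norm.

   Upper bound.  The coefficients of [V^N] are negligible beyond [6 N], and [V]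
   is a causal contraction of l^2, so Hoelder's inequality on windows of length
   [12 N] loses at most [N^|1/2 - 1/p|].

   Lower bound.  By the recurrence in [k], a discrete energy is almost constant
   for [k] in [2N/3, 8N/3], so the coefficients of [V^N] are [O(N^(-1/2))] there;
   by Chebyshev's inequality a fixed part of their l^2 mass lies there too. *)

Set Implicit Arguments.
Unset Strict Implicit.
Unset Printing Implicit Defensive.

Import Order.TTheory GRing.Theory Num.Theory.
Import numFieldNormedType.Exports.
Import ComplexField.Normc.

Local Open Scope ring_scope.

(** * The Taylor coefficients of the Blaschke powers *)

(** The powers of b alone are not orthogonal, because b(0) = -1/2. The factor 1/(1 - s/2) turns them
    into a Takenaka-Malmquist system, and multiplication by 1 - s/2, which is bounded above and
    below, removes it at the end. The generating function sum h j k s^k t^j = 1/(1 - s/2 + t/2 - s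
    t) makes (-1)^j h j k symmetric in j and k, whence recurrences in both indices.

    Powers of W behave better than those of V because on the unit circle |1 + w b| reaches its
    maximum 2 at a single point: a high power lives on an arc of width n^(-1/2) around it, where the
    phase of b is nearly linear. V^N has modulus 1 on the whole circle, so its curved phase spreads
    the coefficients.

    The window [2N/3, 8N/3] answers two demands. The recurrence in k oscillates for N/3 < k < 3N, an
    interval of centre 5N/3 and half-width 4N/3. The weights h N k ^ 2 have mean about 5N/3 and
    standard deviation about 0.943 N. The half-width N lies between the two. *)

Section blaschke_coefficients.
Variable R : realFieldType.
Implicit Types (x y g : nat -> R) (j k n M N : nat).

(* [blaschke_step x] lists the coefficients of [(s - 1/2) / (1 - s/2)] times the
   power series with coefficients [x]. *)
Fixpoint blaschke_step x k : R :=
  if k is k'.+1 then blaschke_step x k' / 2 + x k' - x k'.+1 / 2 else - x 0%N / 2.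

(* Coefficients of [((s - 1/2) / (1 - s/2))^j / (1 - s/2)]. *)
Definition blaschke_coef j : nat -> R := iter j blaschke_step (fun k => 2^-1 ^+ k).

Arguments blaschke_coef : simpl never.
Local Notation h := blaschke_coef.

Lemma h0 k : h 0 k = 2^-1 ^+ k. Proof. by []. Qed.

Lemma hS0 j : h j.+1 0 = - h j 0%N / 2. Proof. by []. Qed.

Lemma hSS j k : h j.+1 k.+1 = h j.+1 k / 2 + h j k - h j k.+1 / 2.
Proof. by []. Qed.

Lemma hj0 j : h j 0 = (- 2^-1) ^+ j.
Proof. by elim: j => [//|j IH]; rewrite hS0 IH exprS; lra. Qed.

(* With the state [z k = 4/3 (y k + x k / 2)], the map from [(x k, z k)] to
   [(y k, z k.+1)] preserves [x^2 + 3/4 z^2]. *)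
Lemma energy x y M :
  (forall k, y k.+1 = y k / 2 + x k - x k.+1 / 2) ->
  \sum_(k < M) y k ^+ 2 + 4 / 3 * (y M + x M / 2) ^+ 2 =
  \sum_(k < M) x k ^+ 2 + 4 / 3 * (y 0%N + x 0%N / 2) ^+ 2.
Proof.
move=> yS; elim: M => [|M IH]; first by rewrite !big_ord0.
rewrite !big_ord_recr /= yS.
have -> : y M / 2 + x M - x M.+1 / 2 + x M.+1 / 2 = y M / 2 + x M by ring.
by move: IH; set u := \sum_(i < M) _; set v := \sum_(i < M) _ => IH; lra.
Qed.

Lemma energy_le x y M :
  (forall k, y k.+1 = y k / 2 + x k - x k.+1 / 2) ->
  \sum_(k < M) y k ^+ 2 <=
  \sum_(k < M) x k ^+ 2 + 4 / 3 * (y 0%N + x 0%N / 2) ^+ 2.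
Proof.
by move=> /energy <-; rewrite lerDl mulr_ge0 ?sqr_ge0// divr_ge0.
Qed.

Lemma sum_h_step g n k : 
  \sum_(j < n) g j * h j.+1 k.+1 =
  (\sum_(j < n) g j * h j.+1 k) / 2 + \sum_(j < n) g j * h j k
    - (\sum_(j < n) g j * h j k.+1) / 2.
Proof.
rewrite !mulr_suml -sumrN -!big_split /=; apply: eq_bigr => j _.
by rewrite hSS; ring.
Qed.

(* The sequences [h j] are pairwise orthogonal with square norm 4/3: adding the
   term [g 0] amounts to starting the recurrence from a nonzero state. *)
Lemma bessel_h g n M :
  \sum_(k < M) (\sum_(j < n) g j * h j k) ^+ 2 <= 4 / 3 * \sum_(j < n) g j ^+ 2.
Proof.
elim: n g => [|n IH] g.
  rewrite big_ord0 mulr0 big1// => k _.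
  by rewrite big_ord0 expr0n.
pose y k := \sum_(j < n.+1) g j * h j k.
pose x k := \sum_(j < n) g j.+1 * h j k.
have yE k : y k = g 0%N * 2^-1 ^+ k + \sum_(j < n) g j.+1 * h j.+1 k.
  by rewrite /y big_ord_recl.
apply: (le_trans (energy_le (x := x) (y := y) M _)) => [k|].
  by rewrite !yE (sum_h_step (fun j => g j.+1)) -/(x _) -/(x _) exprS; lra.
have -> : y 0%N + x 0%N / 2 = g 0%N.
  rewrite yE /x expr0 mulr1 mulr_suml -addrA -big_split /=.
  rewrite [X in _ + X]big1 ?addr0// => j _.
  by rewrite hS0; ring.
rewrite big_ord_recl mulrDr addrC lerD2l; exact: (IH (fun j => g j.+1)).
Qed.

Definition hconv N x k : R := \sum_(i < k.+1) h N i * x (k - i)%N.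

Lemma hconvS N x k :
  hconv N.+1 x k.+1 = hconv N.+1 x k / 2 + hconv N x k - hconv N x k.+1 / 2.
Proof.
rewrite /hconv [LHS]big_ord_recl [X in _ - X / 2]big_ord_recl hS0 !subn0.
under eq_bigr do rewrite subSS hSS.
under [X in _ - (_ + X) / 2]eq_bigr do rewrite subSS.
rewrite (eq_bigr (fun i : 'I_k.+1 => h N.+1 i * x (k - i)%N / 2 + h N i * x (k - i)%N
   - h N i.+1 * x (k - i)%N / 2)); last by move=> i _; ring.
by rewrite !big_split /= sumrN -!mulr_suml; ring.
Qed.

Lemma hconv00 x : hconv 0 x 0 = x 0%N.
Proof. by rewrite /hconv big_ord1 h0 expr0 mul1r. Qed.

Lemma hconv0S x k : hconv 0 x k.+1 = x k.+1 + hconv 0 x k / 2.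
Proof.
rewrite /hconv big_ord_recl h0 expr0 mul1r subn0; congr (_ + _).
rewrite mulr_suml; apply: eq_bigr => i _.
by rewrite subSS /= !h0 exprS; ring.
Qed.

(** One more factor b costs nothing, since [energy_le] starts from a zero state. The constant 4 is
    the square of the l^1 norm 2 of the sequence 2^-k. *)
Lemma hconv_sum_le N x M :
  \sum_(k < M) hconv N x k ^+ 2 <= 4 * \sum_(k < M) x k ^+ 2.
Proof.
elim: N => [|N IH]; last first.
  apply: le_trans IH.
  have := @energy_le (hconv N x) (hconv N.+1 x) M (hconvS N x).
  suff -> : hconv N.+1 x 0 + hconv N x 0 / 2 = 0 by rewrite expr0n mulr0 addr0.
  by rewrite /hconv !big_ord1 hS0; ring.
case: M => [|M]; first by rewrite !big_ord0 mulr0.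
(* The additional square closes the induction: its step then reduces to (z - c/2)^2 >= 0. *)
suff : \sum_(k < M.+1) hconv 0 x k ^+ 2 + hconv 0 x M ^+ 2
    <= 4 * \sum_(k < M.+1) x k ^+ 2.
  by apply: le_trans; rewrite lerDl sqr_ge0.
elim: M => [|M IH]; first by rewrite !big_ord1 hconv00; have := sqr_ge0 (x 0%N); lra.
rewrite !(big_ord_recr M.+1) /= mulrDr.
move: IH; set u := \sum_(i < _) _; set v := \sum_(i < _) _.
rewrite hconv0S; set c := hconv _ _ _; set z := x _ => IH.
have := sqr_ge0 (z - c / 2); lra.
Qed.

(** A Cauchy estimate on the circle of radius 3/2: at s = 3/2 the majorant (s + 1/2)/(1 - s/2) of b
    equals 8, and 8/2 + 1 + 1/3 = 8 (2/3) in the inner induction. *)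
Lemma h_decay j k : `|h j k| <= 8 ^+ j * (2 / 3) ^+ k.
Proof.
elim: j k => [|j IH] k.
  rewrite h0 expr0 mul1r ger0_norm ?exprn_ge0 ?invr_ge0//.
  by rewrite lerXn2r ?nnegrE//; lra.
elim: k => [|k IHk].
  rewrite hS0 expr0 mulr1 normrM normrN (ger0_norm (x := 2^-1)) ?invr_ge0//.
  have := IH 0%N; rewrite expr0 mulr1 exprS.
  have : 0 <= 8 ^+ j :> R by rewrite exprn_ge0.
  set u := 8 ^+ j; lra.
rewrite hSS; have := IH k.+1; have := IH k; move: IHk.
rewrite !exprS.
have : 0 <= 8 ^+ j * (2 / 3) ^+ k :> R by rewrite mulr_ge0 ?exprn_ge0// divr_ge0.
rewrite -!mulrA ![8 ^+ j * (2 * _)]mulrCA ![8 ^+ j * (3^-1 * _)]mulrCA.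
set u := 8 ^+ j * (_ ^+ _).
rewrite !ler_norml => u0 /andP[a1 a2] /andP[b1 b2] /andP[c1 c2].
by apply/andP; split; lra.
Qed.

Lemma h1 k : h 1 k = k%:R * 2 * 2^-1 ^+ k - (k.+1)%:R / 2 * 2^-1 ^+ k.
Proof.
elim: k => [|k IH]; first by rewrite hS0 h0 expr0; lra.
by rewrite hSS IH !h0 !exprS -!natr1; field.
Qed.

(* [s d/ds] maps [b^N / (1 - s/2)] to a combination of [b^(N-1)], [b^N] and
   [b^(N+1)] over [1 - s/2].  The defect [D] obeys the recurrence [hSS]. *)
Lemma h_deriv N k : 3 * k%:R * h N k =
  (5 * N%:R + 1) * h N k + 2 * N.+1%:R * h N.+1 k + 2 * N%:R * h N.-1 k.
Proof.
pose D N k := 3 * k%:R * h N k -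
  ((5 * N%:R + 1) * h N k + 2 * N.+1%:R * h N.+1 k + 2 * N%:R * h N.-1 k).
suff : D N k = 0 by move/eqP; rewrite subr_eq0 => /eqP.
elim: N k => [|N IH] k.
  by rewrite /D h1 h0 /= -natr1; field.
elim: k => [|k IHk].
  by rewrite /D !hj0 /= !exprS -!natr1; field.
have <- : D N.+1 k / 2 + D N k - D N k.+1 / 2 = D N.+1 k.+1; last first.
  by rewrite IHk !IH; lra.
rewrite /D /=; rewrite !hSS /=.
case: N {IH IHk} => [|N] /=.
  by rewrite -!natr1; field.
by rewrite !hSS -!natr1; field.
Qed.

(** Mirror image of [h_deriv] under the symmetry of (-1)^j h j k in j and k. The proof does not pass
    through the symmetry but repeats the argument on the defect. *)
Lemma h_rec N k : 3 * N%:R * h N k =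
  (5 * k%:R + 1) * h N k - 2 * k.+1%:R * h N k.+1 - 2 * k%:R * h N k.-1.
Proof.
pose D N k := 3 * N%:R * h N k -
  ((5 * k%:R + 1) * h N k - 2 * k.+1%:R * h N k.+1 - 2 * k%:R * h N k.-1).
suff : D N k = 0 by move/eqP; rewrite subr_eq0 => /eqP.
elim: N k => [|N IH] k.
  by rewrite /D !h0; case: k => [|k] /=; rewrite !exprS -!natr1; field.
elim: k => [|k IHk].
  rewrite /D hSS !hS0 !hj0 /=.
  have := IH 0%N; rewrite /D !hj0 /= -[N.+1%:R]natr1.
  move: ((- 2^-1) ^+ N : R) (h N 1) (N%:R : R) => u v n; lra.
have <- : D N.+1 k / 2 + D N k - D N k.+1 / 2 = D N.+1 k.+1; last first.
  by rewrite IHk !IH; lra.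
rewrite /D /=; rewrite !hSS /=.
case: k {IHk} => [|k] /=.
  by rewrite -!natr1; field.
by rewrite !hSS -!natr1; field.
Qed.

End blaschke_coefficients.

Arguments blaschke_coef : simpl never.

(** * Wave packets *)

Section packets.
Variable R : realFieldType.

(* [t / (1 + |t|)] is bounded and has derivative [1 / (1 + |t|)^2]. *)
Lemma telescope_weight (t d : R) : 0 < d -> d <= 1 ->
  d / (1 + `|t|) ^+ 2 <= 2 * ((t + d) / (1 + `|t + d|) - t / (1 + `|t|)).
Proof.
move=> d0 d1; have [t0|t0] := leP 0 t.
  rewrite (ger0_norm t0) ger0_norm; last lra.
  have -> : 2 * ((t + d) / (1 + (t + d)) - t / (1 + t)) =
    2 * d * (1 + t) / ((1 + t) ^+ 2 * (1 + (t + d))) by field; lra.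
  rewrite ler_pdivrMr; last by rewrite exprn_gt0//; lra.
  rewrite mulrAC ler_pdivlMr; last by rewrite mulr_gt0 ?exprn_gt0//; lra.
  rewrite -subr_ge0 (_ : _ - _ = (1 + t) ^+ 2 * d * (1 + t - d)); last by ring.
  by rewrite !mulr_ge0 ?sqr_ge0//; lra.
rewrite (ltr0_norm t0); have [t1|t1] := leP (t + d) 0.
  rewrite ler0_norm//.
  have -> : 2 * ((t + d) / (1 - (t + d)) - t / (1 - t)) =
    2 * d * (1 - t) / ((1 - t) ^+ 2 * (1 - (t + d))) by field; lra.
  rewrite ler_pdivrMr; last by rewrite exprn_gt0//; lra.
  rewrite mulrAC ler_pdivlMr; last by rewrite mulr_gt0 ?exprn_gt0//; lra.
  rewrite -subr_ge0 (_ : _ - _ = (1 - t) ^+ 2 * d * (1 - t + d)); last by ring.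
  by rewrite !mulr_ge0 ?sqr_ge0//; lra.
rewrite gtr0_norm//.
have -> : 2 * ((t + d) / (1 + (t + d)) - t / (1 - t)) =
    2 * (d - 2 * t * (t + d)) * (1 - t) / ((1 - t) ^+ 2 * (1 + (t + d))).
  by field; lra.
rewrite ler_pdivrMr; last by rewrite exprn_gt0//; lra.
rewrite mulrAC ler_pdivlMr; last by rewrite mulr_gt0 ?exprn_gt0//; lra.
have tt : 0 <= - t * (t + d) by rewrite mulr_ge0//; lra.
rewrite -subr_ge0 (_ : _ - _ = (1 - t) ^+ 2 * (d * (1 - 3 * t - d) +
  4 * (- t * (t + d)) * (1 - t))); last by ring.
rewrite mulr_ge0 ?sqr_ge0// addr_ge0//; first by rewrite mulr_ge0//; lra.
by rewrite !mulr_ge0//; lra.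
Qed.

(** Carlson's inequality at scale s. With t = (k - k0)/s and w = 1 + |t|, the arithmetic-geometric
    mean gives |v| <= s v^2 w^2 / 2 + 1/(2 s w^2). The first term is controlled by the two
    hypotheses, and the second telescopes by [telescope_weight] to at most 2. *)
Lemma l1_of_weighted_l2 (v : nat -> R) (s k0 P : R) M : 1 <= s ->
  \sum_(k < M) v k ^+ 2 <= P / s ->
  \sum_(k < M) (k%:R - k0) ^+ 2 * v k ^+ 2 <= P * s ->
  \sum_(k < M) `|v k| <= 2 * P + 2.
Proof.
move=> s1 H1 H2; have s0 : 0 < s by lra.
pose t (k : nat) : R := (k%:R - k0) / s.
pose F (x : R) := x / (1 + `|x|).
have F1 x : `|F x| <= 1.
  have w0 : 0 < 1 + `|x| by rewrite addrC ltr_wpDl.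
  by rewrite /F normrM normfV (gtr0_norm w0) ler_pdivrMr// mul1r lerDr.
have tS k : t k.+1 = t k + s^-1 by rewrite /t -natr1; field; lra.
have term k : `|v k| <= (s * v k ^+ 2 + (k%:R - k0) ^+ 2 * v k ^+ 2 / s) + (F (t k.+1) - F (t k)).
  have d1 : s^-1 <= 1 by rewrite invf_le1.
  have d0 : 0 < s^-1 by rewrite invr_gt0.
  have := telescope_weight (t k) d0 d1; rewrite -tS -/(F _) -/(F _).
  set w := 1 + _; have w0 : 0 < w by rewrite /w addrC ltr_wpDl.
  have w2 : w ^+ 2 <= 2 * (1 + t k ^+ 2).
    by rewrite /w -(real_normK (num_real (t k))); have := sqr_ge0 (`|t k| - 1); lra.
  suff : `|v k| <= s * v k ^+ 2 * w ^+ 2 / 2 + s^-1 / w ^+ 2 / 2.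
    have : s * v k ^+ 2 * w ^+ 2 <= s * v k ^+ 2 * (2 * (1 + t k ^+ 2)).
      by rewrite ler_wpM2l// mulr_ge0 ?sqr_ge0//; lra.
    have -> : s * v k ^+ 2 * (2 * (1 + t k ^+ 2)) =
      2 * (s * v k ^+ 2 + (k%:R - k0) ^+ 2 * v k ^+ 2 / s) by rewrite /t; field; lra.
    lra.
  have := sqr_ge0 (`|v k| * s * w ^+ 2 - 1).
  rewrite -subr_ge0 => e0; rewrite -subr_ge0.
  have -> : s * v k ^+ 2 * w ^+ 2 / 2 + s^-1 / w ^+ 2 / 2 - `|v k| =
     ((`|v k| * s * w ^+ 2 - 1) ^+ 2 - 0) / (2 * s * w ^+ 2).
    by rewrite -(real_normK (num_real (v k))); field; lra.
  by rewrite divr_ge0// !mulr_ge0 ?sqr_ge0//; lra.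
apply: le_trans; first by apply: ler_sum => k _; exact: term.
rewrite big_split /= big_split /= -mulr_sumr -mulr_suml.
have -> : \sum_(i < M) (F (t i.+1) - F (t i)) = F (t M) - F (t 0%N).
  by rewrite -(big_mkord xpredT (fun i => F (t i.+1) - F (t i))) telescope_sumr.
have /ler_normlP[? ?] := F1 (t M); have /ler_normlP[? ?] := F1 (t 0%N).
move: H1; rewrite ler_pdivlMr// mulrC => H1.
move: H2; rewrite -ler_pdivrMr// => H2.
lra.
Qed.

(** The binomial law of 2m fair tosses. The even number of tosses puts the mean and the maximum at
    the integer m. *)
Definition bpmf m j : R := 'C(m.*2, j)%:R / 4 ^+ m.

Lemma bpmf_ge0 m j : 0 <= bpmf m j.
Proof. by rewrite divr_ge0// exprn_ge0. Qed.

Lemma bpmf_small m j : (m.*2 < j)%N -> bpmf m j = 0.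
Proof. by move=> mj; rewrite /bpmf bin_small// mul0r. Qed.

Lemma bpmfS m j : j.+1%:R * bpmf m j.+1 = (m.*2%:R - j%:R) * bpmf m j.
Proof.
have [jm|mj] := leqP j m.*2.
  by rewrite /bpmf !mulrA -natrB// -!natrM mul_bin_left.
by rewrite !bpmf_small ?mulr0// (leq_trans mj).
Qed.

(** The offset x is what makes the induction work: Pascal's rule sends it to x + 1 in one half and
    to x - 1 in the other. *)
Lemma bin_moment2 n (x : R) :
  \sum_(j < n.+1) 'C(n, j)%:R * (2 * j%:R - n%:R + x) ^+ 2 = 2 ^+ n * (n%:R + x ^+ 2).
Proof.
elim: n x => [|n IH] x; first by rewrite big_ord1 /= bin0 expr0; ring.
rewrite big_ord_recl /= bin0.
under eq_bigr do rewrite /bump /= binS natrD mulrDl.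
rewrite big_split /= addrA.
have -> : \sum_(i < n.+1) 'C(n, i)%:R * (2 * (1 + i)%:R - n.+1%:R + x) ^+ 2 =
  2 ^+ n * (n%:R + (x + 1) ^+ 2).
  rewrite -IH; apply: eq_bigr => i _; rewrite natrD -[n.+1%:R]natr1; congr (_ * _ ^+ 2); ring.
rewrite [X in _ + X + _]big_ord_recr /= bin_small ?ltnS// mul0r addr0.
have -> : 1%:R * (2 * 0%:R - n.+1%:R + x) ^+ 2 +
   \sum_(i < n) 'C(n, i.+1)%:R * (2 * (1 + i)%:R - n.+1%:R + x) ^+ 2 =
   2 ^+ n * (n%:R + (x - 1) ^+ 2).
  rewrite -IH big_ord_recl /= bin0; congr (_ * _ ^+ 2 + _); first by rewrite -natr1; ring.
  by apply: eq_bigr => i _; rewrite /bump /= natrD -[n.+1%:R]natr1; congr (_ * _ ^+ 2); ring.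
by rewrite [2 ^+ n.+1]exprS -[n.+1%:R]natr1; ring.
Qed.

Lemma bpmf_sum m : \sum_(j < m.*2.+1) bpmf m j = 1.
Proof.
rewrite -mulr_suml -natr_sum.
have -> : (\sum_(i < m.*2.+1) 'C(m.*2, i) = 2 ^ m.*2)%N.
  by rewrite (expnDn 1 1); apply: eq_bigr => i _; rewrite !exp1n !muln1.
by rewrite -mul2n expnM natrX divff// expf_neq0// pnatr_eq0.
Qed.

Lemma bpmf_var m : \sum_(j < m.*2.+1) (j%:R - m%:R) ^+ 2 * bpmf m j = m%:R / 2.
Proof.
transitivity ((\sum_(j < m.*2.+1) 'C(m.*2, j)%:R * (2 * j%:R - m.*2%:R + 0) ^+ 2) /
    4 ^+ m.+1 : R).
  rewrite mulr_suml; apply: eq_bigr => j _.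
  rewrite /bpmf addr0; have -> : m.*2%:R = 2 * m%:R :> R by rewrite -mul2n natrM.
  by rewrite [4 ^+ m.+1]exprS; field; rewrite expf_neq0 ?pnatr_eq0.
rewrite (bin_moment2 m.*2 0) expr0n addr0 [4 ^+ _]exprS -!mul2n exprM natrM.
have -> : 2 ^+ 2 = 4 :> R by ring.
by field; rewrite expf_neq0 ?pnatr_eq0.
Qed.

Lemma bin_central m j : ('C(m.*2, j) <= 'C(m.*2, m))%N.
Proof.
have up i : (i < m)%N -> ('C(m.*2, i) <= 'C(m.*2, i.+1))%N.
  move=> im; rewrite -(leq_pmul2l (ltn0Sn i)) mul_bin_left leq_mul2r; lia.
have upm i d : (i + d <= m)%N -> ('C(m.*2, i) <= 'C(m.*2, i + d))%N.
  elim: d => [|d IH]; first by rewrite addn0.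
  by move=> id; rewrite addnS (leq_trans (IH _)) ?up//; lia.
have lo i : (i <= m)%N -> ('C(m.*2, i) <= 'C(m.*2, m))%N.
  by move=> im; have := upm i (m - i)%N; rewrite subnKC//; apply.
have [jm|mj] := leqP j m; first exact: lo.
have [j2|j2] := leqP j m.*2; last by rewrite bin_small.
by rewrite -bin_sub// lo//; lia.
Qed.

(** At the central index, (2m + 1) [bpmf m m] ^ 2 equals 1 for m = 0 and is multiplied at each step
    by (2m + 1)(2m + 3)/(2m + 2)^2 < 1. *)
Lemma bpmf_le m j (s : R) : 0 <= s -> s ^+ 2 = m.*2.+1%:R -> bpmf m j * s <= 1.
Proof.
move=> s0 s2.
have le1 : bpmf m m * s <= 1.
  rewrite -(@ler_pXn2r _ 2) ?nnegrE ?(mulr_ge0 (bpmf_ge0 _ _))//.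
  rewrite exprMn s2 expr1n {s s0 s2 j}.
  elim: m => [|m IH]; first by rewrite /bpmf bin0 expr0 divr1 expr1n mul1r.
  have E : bpmf m.+1 m.+1 * (2 * m.+1%:R) = (m.*2.+1)%:R * bpmf m m.
    rewrite /bpmf doubleS exprS.
    have : (m.+1 * 'C(m.*2.+2, m.+1) = 2 * (m.*2.+1 * 'C(m.*2, m)))%N.
      have := mul_bin_diag m.*2.+1 m; have := mul_bin_diag m.*2.+2 m => /=.
      have : 'C(m.*2.+1, m.*2.+1 - m) = 'C(m.*2.+1, m) by rewrite bin_sub//; lia.
      have -> : (m.*2.+1 - m = m.+1)%N by lia.
      by move=> -> <- ->; lia.
    move/(congr1 (fun n => n%:R : R)); rewrite !natrM.
    move=> e; transitivity (m.+1%:R * 'C(m.*2.+2, m.+1)%:R / (2 * 4 ^+ m) : R).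
      by field; rewrite expf_neq0 ?pnatr_eq0.
    by rewrite e; field; rewrite expf_neq0 ?pnatr_eq0.
  have m0 : 0 < m.+1%:R :> R by rewrite ltr0n.
  have -> : bpmf m.+1 m.+1 = (m.*2.+1)%:R * bpmf m m / (2 * m.+1%:R).
    by rewrite -E mulfK// mulf_neq0// gt_eqF.
  have e1 i : i.*2.+1%:R = 2 * i%:R + 1 :> R by rewrite -natr1 -mul2n natrM.
  move: IH; rewrite !e1; move: m0; rewrite -[m.+1%:R]natr1.
  move: (bpmf m m) (m%:R : R) (ler0n R m) => q n n0 n1 IH.
  rewrite !exprMn exprVn mulrAC ler_pdivrMr; last by rewrite exprn_gt0//; lra.
  apply: (@le_trans _ _ ((2 * n + 1) * (2 * (n + 1) + 1))).
    rewrite [X in X <= _](_ : _ = (q ^+ 2 * (2 * n + 1)) * ((2 * n + 1) * (2 * (n + 1) + 1))); last by ring.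
    by rewrite ler_piMl// mulr_ge0//; lra.
  by rewrite -subr_ge0 (_ : _ - _ = 1)//; ring.
apply: le_trans le1; rewrite ler_wpM2r// /bpmf ler_wpM2r ?invr_ge0 ?exprn_ge0//.
by rewrite ler_nat bin_central.
Qed.

End packets.

Section packet_l1.
Variable R : realFieldType.
Local Notation h := (@blaschke_coef R).

(** By [h_deriv], multiplication by the position k becomes a tridiagonal operator on the
    coefficients g, to which [bessel_h] applies again. The vanishing of g at n and n + 1 removes the
    boundary terms of the summation by parts. *)
Lemma sum_position_h (g : nat -> R) n (c : R) k : g n = 0 -> g n.+1 = 0 ->
  3 * (k%:R - c) * (\sum_(j < n) g j * h j k) =
  \sum_(j < n.+1) ((5 * j%:R + 1 - 3 * c) * g j + 2 * j%:R * g j.-1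
     + 2 * j.+1%:R * g j.+1) * h j k.
Proof.
move=> gn gn1.
transitivity (\sum_(j < n) (5 * j%:R + 1 - 3 * c) * g j * h j k
  + \sum_(j < n) 2 * j.+1%:R * g j * h j.+1 k
  + \sum_(j < n) 2 * j%:R * g j * h j.-1 k).
  rewrite mulr_sumr -!big_split /=; apply: eq_bigr => j _.
  have -> : 3 * (k%:R - c) * (g j * h j k) = g j * (3 * k%:R * h j k) - 3 * c * g j * h j k by ring.
  by rewrite h_deriv; ring.
under [RHS]eq_bigr do rewrite 2!mulrDl.
rewrite !big_split /=; congr (_ + _ + _).
- by rewrite [RHS]big_ord_recr /= gn mulr0 mul0r addr0.
- by rewrite [RHS]big_ord_recl /= mulr0 !mul0r add0r.
rewrite [RHS]big_ord_recr /= gn1 mulr0 mul0r addr0.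
case: n gn {gn1} => [|n] gn; first by rewrite !big_ord0.
rewrite [LHS]big_ord_recl [RHS]big_ord_recr /= gn !(mulr0, mul0r) add0r addr0.
by apply: eq_bigr => j _.
Qed.

(** [al j] stands for the real or imaginary part of w^(j - 1), with |w| = 1 and c = Re w; the shift
    of index avoids a negative one in [gam]. The centre [k0] is the value for which [gam] vanishes
    to leading order: putting j = m in its weights and using [alS] leaves 5m + 4cm - 3 k0 = 0. *)
Variables (al : nat -> R) (c s : R) (m : nat).
Hypothesis al1 : forall j, `|al j| <= 1.
Hypothesis alS : forall j, al j.+2 + al j = 2 * c * al j.+1.
Hypotheses (s1 : 1 <= s) (s2 : s ^+ 2 = m.*2.+1%:R).
Local Notation p := (@bpmf R m).
Local Notation e j := (j%:R - m%:R : R).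
Local Notation g := (fun j => p j * al j.+1).
Local Notation k0 := (m%:R * (5 + 4 * c) / 3).
Local Notation gam j := ((5 * j%:R + 1 - 3 * k0) * g j + 2 * j%:R * g j.-1
     + 2 * j.+1%:R * g j.+1).

Let s0 : 0 < s. Proof. exact: lt_le_trans ltr01 s1. Qed.

Let ps j : p j <= 1 / s.
Proof. by rewrite ler_pdivlMr// bpmf_le// ltW. Qed.

(** The largest weight times the total mass; the next lemma is the largest weight times the variance
    m/2. *)
Lemma sum_bpmf_sq : \sum_(j < m.*2.+1) p j ^+ 2 <= 1 / s.
Proof.
rewrite -[leRHS]mulr1 -[X in _ * X](bpmf_sum R m) mulr_sumr; apply: ler_sum => j _.
by rewrite expr2 ler_wpM2r// bpmf_ge0.
Qed.

Lemma sum_bpmf_var_sq : \sum_(j < m.*2.+1) e j ^+ 2 * p j ^+ 2 <= s / 4.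
Proof.
apply: (@le_trans _ _ (1 / s * (m%:R / 2))).
  rewrite -bpmf_var mulr_sumr; apply: ler_sum => j _.
  by rewrite [p _ ^+ 2]expr2 mulrCA ler_wpM2r// mulr_ge0 ?sqr_ge0 ?bpmf_ge0.
have : 2 * m%:R <= s ^+ 2 by rewrite s2 -natrM ler_nat; lia.
rewrite mul1r ler_pdivrMl// => H; rewrite (_ : s * (s / 4) = s ^+ 2 / 4); last by ring.
lra.
Qed.

Let sq4 (x y z t : R) : (x + y + z + t) ^+ 2 <=
  4 * (x ^+ 2 + y ^+ 2 + z ^+ 2 + t ^+ 2).
Proof.
have := sqr_ge0 (x - y); have := sqr_ge0 (x - z); have := sqr_ge0 (x - t).
have := sqr_ge0 (y - z); have := sqr_ge0 (y - t); have := sqr_ge0 (z - t).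
lra.
Qed.

Let abs_le (x y u : R) : `|u| <= 1 -> `|x| <= y -> `|x * u| <= y.
Proof.
move=> u1 xy; rewrite normrM; apply: le_trans xy.
by rewrite ler_piMr.
Qed.

(** All terms of size m cancel: [alS] distributes the part 4cm of 3 k0 over the two neighbours,
    where [bpmfS] rewrites the weights. Each remaining term carries a deviation [e] from the mean or
    a bounded factor. *)
Let gamS j : `|gam j.+1| <=
  9 * `|e j.+1| * p j.+1 + p j.+1 + 4 * `|e j| * p j + 2 * p j.
Proof.
have E1 := bpmfS R m j; have E2 := bpmfS R m j.+1; have E3 := alS j.+1.
have -> : gam j.+1 = (5 * e j.+1 * p j.+1) * al j.+2 + p j.+1 * al j.+2
   + - (2 * e j.+1 * p j.+1) * al j.+3 + (4 * e j * p j) * al j.+1 + 2 * p j * al j.+1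
   + 2 * e j.+1 * p j.+1 * al j.+1.
  have -> : 2 * j.+2%:R * (p j.+2 * al j.+3) = 2 * (j.+2%:R * p j.+2) * al j.+3 by ring.
  rewrite E2.
  have -> : (5 * j.+1%:R + 1 - 3 * k0) * (p j.+1 * al j.+2) =
    (5 * j.+1%:R + 1 - 5 * m%:R) * p j.+1 * al j.+2 - 2 * m%:R * p j.+1 * (2 * c * al j.+2).
    by field.
  rewrite -E3 /=; have Ej : j.+1%:R = j%:R + 1 :> R by rewrite natr1.
  have Em : m.*2%:R = 2 * m%:R :> R by rewrite -mul2n natrM.
  move: E1; rewrite Em !Ej => E1.
  move: (p j) (p j.+1) (al j.+1) (al j.+2) (al j.+3) (j%:R : R) (m%:R : R) E1 => a b x y z n mm E1.
  suff : 2 * x * ((n + 1) * b - (2 * mm - n) * a) = 0 by lra.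
  by rewrite E1; ring.
have P0 := bpmf_ge0 R m j; have P1 := bpmf_ge0 R m j.+1.
have b1 : `|5 * e j.+1 * p j.+1 * al j.+2| <= 5 * `|e j.+1| * p j.+1.
  by apply: abs_le => //; rewrite 2!normrM (ger0_norm P1) (@ger0_norm _ 5).
have b2 : `|p j.+1 * al j.+2| <= p j.+1 by apply: abs_le => //; rewrite ger0_norm.
have b3 : `|- (2 * e j.+1 * p j.+1) * al j.+3| <= 2 * `|e j.+1| * p j.+1.
  by apply: abs_le => //; rewrite normrN 2!normrM (ger0_norm P1) (@ger0_norm _ 2).
have b4 : `|4 * e j * p j * al j.+1| <= 4 * `|e j| * p j.
  by apply: abs_le => //; rewrite 2!normrM (ger0_norm P0) (@ger0_norm _ 4).
have b5 : `|2 * p j * al j.+1| <= 2 * p j.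
  by apply: abs_le => //; rewrite normrM (ger0_norm P0) (@ger0_norm _ 2).
have b6 : `|2 * e j.+1 * p j.+1 * al j.+1| <= 2 * `|e j.+1| * p j.+1.
  by apply: abs_le => //; rewrite 2!normrM (ger0_norm P1) (@ger0_norm _ 2).
apply: (le_trans (ler_normD _ _)); apply: le_trans (lerD (ler_normD _ _) b6) _.
apply: le_trans (lerD (lerD (ler_normD _ _) b5) (lexx _)) _.
apply: le_trans (lerD (lerD (lerD (ler_normD _ _) b4) (lexx _)) (lexx _)) _.
apply: le_trans (lerD (lerD (lerD (lerD (ler_normD _ _) b3) (lexx _)) (lexx _)) (lexx _)) _.
apply: le_trans (lerD (lerD (lerD (lerD (lerD b1 b2) (lexx _)) (lexx _)) (lexx _)) (lexx _)) _.
lra.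
Qed.

Let gam0 : `|gam 0%N| <= 9 * `|e 0%N| * p 0%N + p 0%N.
Proof.
have E2 := bpmfS R m 0; have E3 := alS 0.
have -> : gam 0%N = (5 * e 0%N * p 0%N) * al 1%N + p 0%N * al 1%N
   + (- (2 * e 0%N * p 0%N)) * al 2%N + 2 * e 0%N * p 0%N * al 0%N.
  have -> : 2 * 1%:R * (p 1%N * al 2%N) = 2 * (1%:R * p 1%N) * al 2%N by ring.
  rewrite E2.
  have -> : (5 * 0%:R + 1 - 3 * k0) * (p 0%N * al 1%N) =
    (5 * 0%:R + 1 - 5 * m%:R) * p 0%N * al 1%N - 2 * m%:R * p 0%N * (2 * c * al 1%N).
    by field.
  rewrite -E3 /=.
  have -> : m.*2%:R = 2 * m%:R :> R by rewrite -mul2n natrM.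
  ring.
have P1 := bpmf_ge0 R m 0.
have b1 : `|5 * e 0%N * p 0%N * al 1%N| <= 5 * `|e 0%N| * p 0%N.
  by apply: abs_le => //; rewrite 2!normrM (ger0_norm P1) (@ger0_norm _ 5).
have b2 : `|p 0%N * al 1%N| <= p 0%N by apply: abs_le => //; rewrite ger0_norm.
have b3 : `|- (2 * e 0%N * p 0%N) * al 2%N| <= 2 * `|e 0%N| * p 0%N.
  by apply: abs_le => //; rewrite normrN 2!normrM (ger0_norm P1) (@ger0_norm _ 2).
have b6 : `|2 * e 0%N * p 0%N * al 0%N| <= 2 * `|e 0%N| * p 0%N.
  by apply: abs_le => //; rewrite 2!normrM (ger0_norm P1) (@ger0_norm _ 2).
apply: (le_trans (ler_normD _ _)); apply: le_trans (lerD (ler_normD _ _) b6) _.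
apply: le_trans (lerD (lerD (ler_normD _ _) b3) (lexx _)) _.
apply: le_trans (lerD (lerD (lerD b1 b2) (lexx _)) (lexx _)) _.
lra.
Qed.

Let sq_le (x y : R) : `|x| <= y -> x ^+ 2 <= y ^+ 2.
Proof.
move=> xy; rewrite -(real_normK (num_real x)) lerXn2r ?nnegrE//.
exact: le_trans xy.
Qed.

(** With [sq4] the bound is 4 (81 + 16) s/4 + 4 (1 + 4)/s, at most 117 s. *)
Lemma sum_gam_sq : \sum_(j < m.*2.+2) gam j ^+ 2 <= 120 * s.
Proof.
rewrite big_ord_recl.
have H0 : gam 0%N ^+ 2 <= 4 * (81 * (e 0%N ^+ 2 * p 0%N ^+ 2) + p 0%N ^+ 2).
  apply: (le_trans (sq_le gam0)); have := sq4 (9 * `|e 0%N| * p 0%N) (p 0%N) 0 0.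
  by rewrite !addr0 !exprMn (real_normK (num_real _)); lra.
have HS j : gam j.+1 ^+ 2 <= 4 * (81 * (e j.+1 ^+ 2 * p j.+1 ^+ 2) + p j.+1 ^+ 2)
    + 4 * (16 * (e j ^+ 2 * p j ^+ 2) + 4 * p j ^+ 2).
  apply: (le_trans (sq_le (gamS j))).
  apply: (le_trans (sq4 _ _ _ _)).
  by rewrite !exprMn !(real_normK (num_real _)); lra.
have HH : \sum_(j < m.*2.+1) gam j.+1 ^+ 2 <= \sum_(j < m.*2.+1)
  (4 * (81 * (e j.+1 ^+ 2 * p j.+1 ^+ 2) + p j.+1 ^+ 2)
    + 4 * (16 * (e j ^+ 2 * p j ^+ 2) + 4 * p j ^+ 2)).
  by apply: ler_sum => j _; exact: HS.
apply: (le_trans (lerD H0 HH)).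
rewrite big_split /= addrA.
have -> : 4 * (81 * (e 0%N ^+ 2 * p 0%N ^+ 2) + p 0%N ^+ 2) + 
  \sum_(i < m.*2.+1) (4 * (81 * (e i.+1 ^+ 2 * p i.+1 ^+ 2) + p i.+1 ^+ 2)) =
  \sum_(i < m.*2.+1) (4 * (81 * (e i ^+ 2 * p i ^+ 2) + p i ^+ 2)).
  transitivity (\sum_(i < m.*2.+2) (4 * (81 * (e i ^+ 2 * p i ^+ 2) + p i ^+ 2))).
    by rewrite [RHS]big_ord_recl.
  rewrite big_ord_recr /= (bpmf_small _ (j := m.*2.+1))//.
  by rewrite expr0n /= !mulr0 addr0 mulr0 addr0.
rewrite -!mulr_sumr !big_split /= -!mulr_sumr.
have := sum_bpmf_sq; have := sum_bpmf_var_sq.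
have : 1 / s <= s by rewrite ler_pdivrMr ?mulr_ege1//.
set u := \sum_(i < _) _ ; set v := \sum_(i < _) _.
by move: u v (1 / s) (s) s0 => *; lra.
Qed.

Lemma packet_l1 M : 
  \sum_(k < M) `|\sum_(j < m.*2.+1) p j * al j.+1 * h j k| <= 40.
Proof.
pose v k := \sum_(j < m.*2.+1) p j * al j.+1 * h j k.
(* P = 18 dominates (4/3) 120/9, the moment bound after division by 3^2, and 2 P + 2 = 38. *)
apply: (le_trans (l1_of_weighted_l2 (v := v) (s := s) (k0 := k0) (P := 18) s1 _ _)); last lra.
- apply: (le_trans (bessel_h g _ M)).
  have : \sum_(j < m.*2.+1) g j ^+ 2 <= \sum_(j < m.*2.+1) p j ^+ 2.
    apply: ler_sum => j _; apply: sq_le; apply: abs_le => //.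
    by rewrite ger0_norm ?bpmf_ge0.
  have := sum_bpmf_sq; rewrite !ler_pdivlMr//.
  move: (\sum_(_ < _) _) (\sum_(_ < _) _) => a b.
  move: (s) s0 => t t0 H1 H2; have := ler_wpM2r (ltW t0) H2; lra.
- rewrite -(ler_pM2l (ltr0n _ 9)).
  have -> : 9%:R * \sum_(k < M) (k%:R - k0) ^+ 2 * v k ^+ 2 =
    \sum_(k < M) (3 * (k%:R - k0) * v k) ^+ 2.
    by rewrite mulr_sumr; apply: eq_bigr => k _; ring.
  under eq_bigr => k _.
    rewrite (@sum_position_h g); last 2 first.
    - by rewrite bpmf_small ?mul0r.
    - by rewrite bpmf_small ?mul0r.
    over.
  apply: (le_trans (bessel_h (fun j => gam j) _ M)).
  have := sum_gam_sq; set u := \sum_(_ < _) _; by move: u (s) s0 => *; lra.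
Qed.

End packet_l1.

(** * Spreading of the powers *)

Section spreading.
Variable R : realFieldType.
Local Notation h := (@blaschke_coef R).

Lemma sum_h_sq_le N M : \sum_(k < M) h N k ^+ 2 <= 4 / 3.
Proof.
have dE (f : nat -> R) : \sum_(j < N.+1) (j == N :> nat)%:R * f j = f N.
  rewrite big_ord_recr /= eqxx mul1r big1 ?add0r// => j _.
  by rewrite ltn_eqF ?mul0r.
have := bessel_h (fun j => (j == N)%:R : R) N.+1 M.
under [X in 4 / 3 * X]eq_bigr do rewrite expr2.
rewrite (dE (fun j => (j == N)%:R)) eqxx mulr1.
by under eq_bigr do rewrite (dE (fun j => h j _)).
Qed.

(* If [c k] were constant, [y k.+1 + y k.-1 = c k * y k] would preserve
   [y k.+1 ^ 2 + y k ^ 2 - c k * y k * y k.+1]. *)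
Definition h_energy N k : R := 4 * k.+1%:R ^+ 2 * (h N k.+1 ^+ 2 + h N k ^+ 2)
  - 2 * k.+1%:R * (5 * k%:R + 1 - 3 * N%:R) * h N k * h N k.+1.

Lemma h_energyS N k : h_energy N k.+1 - h_energy N k =
  (8 * k.+1%:R + 4) * h N k.+1 ^+ 2 - 10 * k.+1%:R * h N k * h N k.+1.
Proof.
have := h_rec R N k.+1; rewrite /h_energy /= -[k.+2%:R]natr1.
move: (h N k.+2) (h N k.+1) (h N k) => z y x.
rewrite -[k.+1%:R]natr1; move: (k%:R : R) (N%:R : R) => a n H.
have e : 2 * (a + 1 + 1) * z = (5 * (a + 1) + 1 - 3 * n) * y - 2 * (a + 1) * x by lra.
transitivity ((2 * (a + 1 + 1) * z) * (2 * (a + 1 + 1) * z - (5 * (a + 1) + 1 - 3 * n) * y)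
  + 4 * (a + 1 + 1) ^+ 2 * y ^+ 2 - (4 * (a + 1) ^+ 2 * (y ^+ 2 + x ^+ 2)
  - 2 * (a + 1) * (5 * a + 1 - 3 * n) * x * y)); first by ring.
rewrite e; ring.
Qed.

(** In the window |5k + 1 - 3N| <= (31/8)(k + 1), the worst end being k + 1 = 8N/3, where 5 - 9/8 =
    31/8. Since 31/8 < 4, the quadratic form is definite with margin 1/8. *)
Lemma h_energy_bounds N k : (2 <= N)%N -> (2 * N <= 3 * k.+1 <= 8 * N)%N ->
  k.+1%:R ^+ 2 / 8 * (h N k.+1 ^+ 2 + h N k ^+ 2) <= h_energy N k
    <= 8 * k.+1%:R ^+ 2 * (h N k.+1 ^+ 2 + h N k ^+ 2).
Proof.
rewrite -(ler_nat R) => N2 /andP[]; rewrite -2!(ler_nat R) !natrM => k1 k2.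
rewrite /h_energy -[k%:R](addrK 1) natr1.
move: (h N k.+1) (h N k) (N%:R : R) (k.+1%:R : R) N2 k1 k2 => y x n a n2 a1 a2.
have a0 : 0 <= a by lra.
have xy : `|x * y| <= (y ^+ 2 + x ^+ 2) / 2.
  by rewrite ler_norml; have := sqr_ge0 (x + y); have := sqr_ge0 (x - y); lra.
have ca : `|5 * (a - 1) + 1 - 3 * n| <= 31 / 8 * a by rewrite ler_norml; lra.
have key : `|2 * a * (5 * (a - 1) + 1 - 3 * n) * x * y| <= 2 * a * (31 / 8 * a) * ((y ^+ 2 + x ^+ 2) / 2).
  rewrite -mulrA normrM normrM [`|2 * a|]ger0_norm; last lra.
  apply: ler_pM => //; first by rewrite mulr_ge0//; lra.
  by rewrite ler_wpM2l//; lra.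
move: key; rewrite ler_norml; have := sqr_ge0 a; have := mulr_ge0 (sqr_ge0 a) (addr_ge0 (sqr_ge0 y) (sqr_ge0 x)).
lra.
Qed.

Lemma h_energy_slow N k : (2 <= N)%N -> (2 * N <= 3 * k.+1 <= 8 * N)%N ->
  `|h_energy N k.+1 - h_energy N k| <= 204 / N%:R * h_energy N k.
Proof.
move=> N2 kN; have /andP[lo _] := h_energy_bounds N2 kN.
have N0 : 0 < N%:R :> R by rewrite ltr0n; lia.
have k1 : N%:R <= 3 / 2 * k.+1%:R :> R.
  by have /andP[+ _] := kN; rewrite -(ler_nat R) !natrM; lra.
have k1' : 1 <= k.+1%:R :> R by rewrite ler1n.
have xy : `|h N k * h N k.+1| <= (h N k.+1 ^+ 2 + h N k ^+ 2) / 2.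
  rewrite ler_norml; have := sqr_ge0 (h N k.+1 + h N k); have := sqr_ge0 (h N k.+1 - h N k); lra.
have step1 : `|h_energy N k.+1 - h_energy N k| <= 17 * k.+1%:R * (h N k.+1 ^+ 2 + h N k ^+ 2).
  rewrite h_energyS; move: xy; rewrite -mulrA.
  move: (h N k * h N k.+1) (k.+1%:R : R) k1' (sqr_ge0 (h N k.+1)) (sqr_ge0 (h N k)) => u a a1.
  move: (h N k.+1 ^+ 2) (h N k ^+ 2) => y x y0 x0 /ler_normlP[u1 u2].
  have a0 : 0 <= a by lra.
  have m1 := ler_wpM2l a0 u1; have m2 := ler_wpM2l a0 u2.
  have m3 : 0 <= (a - 1) * y by rewrite mulr_ge0//; lra.
  have m4 := mulr_ge0 a0 x0; have m5 := mulr_ge0 a0 y0.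
  by rewrite ler_norml; apply/andP; split; lra.
apply: (le_trans step1); rewrite (_ : 204 / _ * _ = N%:R^-1 * (204 * h_energy N k)) ?ler_pdivlMl//; last by ring.
have s0 : 0 <= h N k.+1 ^+ 2 + h N k ^+ 2 by rewrite addr_ge0 ?sqr_ge0.
move: (h N k.+1 ^+ 2 + h N k ^+ 2) (h_energy N k) s0 lo => s e s0 lo.
have := ler_wpM2r (mulr_ge0 (le_trans ler01 k1') s0) k1; lra.
Qed.

(** A discrete Gronwall inequality, usable in both directions. *)
Lemma chain_le (f : nat -> R) (kap : R) a b : 1 <= kap ->
  (forall i, (a <= i <= b)%N -> 0 <= f i) ->
  (forall i, (a <= i < b)%N -> f i.+1 <= kap * f i /\ f i <= kap * f i.+1) ->
  forall i j n, (a <= i <= b)%N -> (a <= j <= b)%N -> (i <= j + n)%N -> (j <= i + n)%N ->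
  f i <= kap ^+ n * f j.
Proof.
move=> kap1 f0 fS.
have kap0 : 0 <= kap by lra.
suff H i d : (a <= i)%N -> (i + d <= b)%N ->
    f i <= kap ^+ d * f (i + d)%N /\ f (i + d)%N <= kap ^+ d * f i.
  move=> i j n /andP[ai ib] /andP[aj jb] ij ji.
  have mono d x : (d <= n)%N -> 0 <= x -> kap ^+ d * x <= kap ^+ n * x.
    by move=> dn x0; rewrite ler_wpM2r// ler_weXn2l.
  have [le|/ltnW le] := leqP i j.
    have [] := H i (j - i)%N ai; first by rewrite subnKC.
    rewrite subnKC// => + _; move=> /le_trans; apply; apply: mono; first lia.
    by apply: f0; rewrite aj.
  have [] := H j (i - j)%N aj; first by rewrite subnKC.
  rewrite subnKC// => _; move=> /le_trans; apply; apply: mono; first lia.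
  by apply: f0; rewrite aj.
elim: d => [|d IH] ai ib; first by rewrite addn0 expr0 !mul1r.
have [||h1 h2] := IH => //; first lia.
have [|h3 h4] := fS (i + d)%N; first lia.
rewrite addnS; split.
  by apply: (le_trans h1); rewrite exprSr -mulrA ler_wpM2l ?exprn_ge0.
by apply: (le_trans h3); rewrite exprS -mulrA ler_wpM2l.
Qed.

(** The energies in the window agree up to the factor K, so each is bounded by their average over N
    <= k < 2N, where the total mass is at most 4/3. The number 408 is twice the rate 204 of
    [h_energy_slow]: for q = 204/N <= 1/2 one has 1/(1 - q) <= 1 + 2q. *)
Lemma h_sup N (K : R) k : (408 <= N)%N -> (1 + 408 / N%:R) ^+ (3 * N) <= K ->
  (2 * N <= 3 * k <= 8 * N)%N -> N%:R * h N k ^+ 2 <= 1800 * K.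
Proof.
move=> N4 HK kN; have N2 : (2 <= N)%N by lia.
have N0 : 0 < N%:R :> R by rewrite ltr0n; lia.
have N408 : 408 <= N%:R :> R by rewrite ler_nat.
set q : R := 204 / N%:R.
have q0 : 0 < q := divr_gt0 (ltr0Sn _ _) N0.
have q1 : q <= 1 / 2 by rewrite ler_pdivrMr//; lra.
set kap : R := 1 + 408 / N%:R.
have kq : kap = 1 + 2 * q by rewrite /kap /q; lra.
have kap1 : 1 <= kap by lra.
case: k kN => [|k] kN; first by move: kN N2; clear; lia.
have E0 i : (2 * N <= 3 * i.+1 <= 8 * N)%N -> 0 <= h_energy N i.
  move=> /(h_energy_bounds N2) /andP[+ _]; apply: le_trans.
  by rewrite mulr_ge0 ?divr_ge0 ?sqr_ge0// addr_ge0 ?sqr_ge0.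
(* [h_energy N i] involves the entries i and i + 1, and its bounds constrain i + 1; hence the
   predecessors. *)
pose a := ((2 * N + 2) %/ 3).-1%N; pose b := ((8 * N) %/ 3).-1%N.
have ab i : (a <= i <= b)%N -> (2 * N <= 3 * i.+1 <= 8 * N)%N by move: N2; rewrite /a /b; clear; lia.
have H i j : (a <= i <= b)%N -> (a <= j <= b)%N -> h_energy N i <= K * h_energy N j.
  move=> ia ja; apply: (@le_trans _ _ (kap ^+ (3 * N) * h_energy N j)).
    apply: (@chain_le (h_energy N) kap a b) => //.
    - by move=> l /ab; exact: E0.
    - move=> l lab; have := @h_energy_slow N l N2; rewrite -/q.
      have l1 : (a <= l <= b)%N by move: lab; clear; lia.
      have l2 : (a <= l.+1 <= b)%N by move: lab; clear; lia.
      move=> /(_ (ab _ l1)); have := E0 _ (ab _ l1); have := E0 _ (ab _ l2).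
      move: (h_energy N l) (h_energy N l.+1) => x y y0 x0 /ler_normlP[h1 h2]; rewrite kq; split.
        have := mulr_ge0 (ltW q0) x0; lra.
      have := ler_wpM2r x0 q1 => h3.
      have h4 := ler_wpM2l (ltW q0) (_ : x <= 2 * y); have := h4 ltac:(lra); lra.
    - by move: N2 ia ja; rewrite /a /b; clear; lia.
    - by move: N2 ia ja; rewrite /a /b; clear; lia.
  by rewrite ler_wpM2r// E0// ab.
have kab : (a <= k <= b)%N by move: N2 kN; rewrite /a /b; clear; lia.
have /andP[lo _] := h_energy_bounds N2 kN.
have K0 : 0 <= K := le_trans (exprn_ge0 _ (le_trans ler01 kap1)) HK.
have sumE : N%:R * h_energy N k <= K * (86 * N%:R ^+ 2).
  apply: (@le_trans _ _ (\sum_(j < N) K * h_energy N (N + j)%N)).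
    rewrite mulr_natl -[N in _ *+ N]card_ord -sumr_const; apply: ler_sum => j _.
    by apply: H => //; have := ltn_ord j; move: N2; rewrite /a /b; clear; lia.
  rewrite -mulr_sumr ler_wpM2l//.
  apply: (@le_trans _ _ (\sum_(j < N) 8 * (4 * N%:R ^+ 2) * (h N (N + j).+1 ^+ 2 + h N (N + j) ^+ 2))).
    apply: ler_sum => j _; have jN := ltn_ord j.
    have jb : (2 * N <= 3 * (N + j).+1 <= 8 * N)%N by move: jN; clear; lia.
    have /andP[_ up] := h_energy_bounds N2 jb; apply: (le_trans up).
    rewrite ler_wpM2r ?addr_ge0 ?sqr_ge0// ler_wpM2l//.
    have -> : 4 * N%:R ^+ 2 = (2 * N%:R) ^+ 2 :> R by ring.
    by rewrite lerXn2r ?nnegrE ?mulr_ge0// -natrM ler_nat; move: jN; clear; lia.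
  rewrite -mulr_sumr big_split /=.
  have e1 : \sum_(j < N) h N (N + j) ^+ 2 <= 4 / 3.
    apply: le_trans (sum_h_sq_le N (N + N)).
    by rewrite [leRHS]big_split_ord /= lerDr sumr_ge0// => *; exact: sqr_ge0.
  have e2 : \sum_(j < N) h N (N + j).+1 ^+ 2 <= 4 / 3.
    apply: le_trans (sum_h_sq_le N (N.+1 + N)).
    by rewrite [leRHS]big_split_ord /= lerDr sumr_ge0// => *; exact: sqr_ge0.
  have := sqr_ge0 (N%:R : R); move: (N%:R ^+ 2) e1 e2 => m; set u := \sum_(_ < _) _; set v := \sum_(_ < _) _ => u1 v1 m0.
  have := ler_wpM2l m0 u1; have := ler_wpM2l m0 v1; lra.
have k2 : N%:R ^+ 2 <= 9 / 4 * k.+1%:R ^+ 2 :> R.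
  have : 2 * N%:R <= 3 * k.+1%:R :> R.
    by have /andP[+ _] := kN; rewrite -(ler_nat R) !natrM.
  move: (k.+1%:R : R) => t nt; have := lerXn2r 2 (_ : 2 * N%:R \is Num.nneg) (_ : 3 * t \is Num.nneg) nt.
  rewrite !nnegrE !exprMn => HH; have := HH ltac:(lra) ltac:(lra); lra.
have N20 : 0 < N%:R ^+ 2 :> R by rewrite exprn_gt0.
have X0 : 0 <= h N k.+1 ^+ 2 by exact: sqr_ge0.
have Y0 : 0 <= h N k ^+ 2 by exact: sqr_ge0.
rewrite -(ler_pM2l N20).
have c1 := ler_wpM2r X0 k2.
have c2 := mulr_ge0 (sqr_ge0 (k.+1%:R : R)) Y0.
have c3 : N%:R ^+ 2 * h N k.+1 ^+ 2 <= 18 * h_energy N k by lra.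
have := ler_wpM2l (ltW N0) c3; have := mulr_ge0 K0 (ltW N20); lra.
Qed.

(** Iterating [energy] over the powers: the mass missing from the first M entries sits in the states
    stored at M. *)
Lemma h_total N M : \sum_(k < M) h N k ^+ 2 =
  4 / 3 * (1 - 4^-1 ^+ M) - \sum_(j < N) 4 / 3 * (h j.+1 M + h j M / 2) ^+ 2.
Proof.
elim: N => [|N IH].
  rewrite big_ord0 subr0; elim: M => [|M IH]; first by rewrite big_ord0 expr0; lra.
  have e : (2^-1 ^+ M) ^+ 2 = 4^-1 ^+ M :> R.
    by rewrite exprAC; congr (_ ^+ _); field.
  by rewrite big_ord_recr /= IH h0 e [4^-1 ^+ M.+1]exprS; lra.
rewrite big_ord_recr /=; have := @energy R (h N) (h N.+1) M (hSS R N).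
rewrite IH hS0 => e; apply: (addIr (4 / 3 * (h N.+1 M + h N M / 2) ^+ 2)).
rewrite e; lra.
Qed.

(** Read [h_deriv] as (3k - 5N - 1) h N k = 2(N + 1) h (N + 1) k + 2N h (N - 1) k. The square norm
    of the right side is at most (16/3)((N + 1)^2 + N^2), while |3k - 5N - 1| >= 3N off the window:
    the mass there is at most about 32/27, out of a total close to 4/3. *)
Lemma h_mass N : (20 <= N)%N ->
  1 / 20 <= \sum_(k < 12 * N | (2 * N <= 3 * k <= 8 * N)%N) h N k ^+ 2.
Proof.
move=> N20; set M := (12 * N)%N; set P := fun k : 'I_M => (2 * N <= 3 * k <= 8 * N)%N.
have N1 : 20 <= N%:R :> R by rewrite ler_nat.
have tot : 132 / 100 <= \sum_(k < M) h N k ^+ 2.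
  (* The cut-off 12 N works because 8 (2/3)^12 < 1/10 and 10^N >= 10 N. *)
  have small j : (j <= N)%N -> `|h j M| <= (10 * N%:R)^-1.
    move=> jN; apply: (le_trans (h_decay _ _ _)).
    apply: (@le_trans _ _ (8 ^+ N * (2 / 3) ^+ M)).
      by rewrite ler_wpM2r ?exprn_ge0 ?divr_ge0// ler_weXn2l//; lra.
    rewrite exprM -exprMn; apply: (@le_trans _ _ (10^-1 ^+ N)).
      have q8 : 0 <= 8 * (2 / 3) ^+ 12 :> R.
        exact: mulr_ge0 (ler0n _ _) (exprn_ge0 _ (divr_ge0 (ler0n _ _) (ler0n _ _))).
      apply: lerXn2r; rewrite ?nnegrE ?invr_ge0//.
      have -> : (2 / 3) ^+ 12 = ((2 / 3) ^+ 4) ^+ 3 :> R by rewrite -exprM.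
      have : ((2 / 3) ^+ 4) ^+ 3 <= (1 / 5) ^+ 3 :> R.
        by rewrite lerXn2r ?nnegrE ?divr_ge0 ?exprn_ge0//; lra.
      lra.
    rewrite exprVn lef_pV2 ?posrE ?exprn_gt0 ?mulr_gt0//; last by rewrite ltr0n; lia.
    rewrite -natrM -natrX ler_nat; elim: (N) => [//|n IHn].
    by rewrite expnS; nia.
  rewrite h_total.
  have : 4^-1 ^+ M <= 1 / 1000 :> R.
    apply: (@le_trans _ _ (4^-1 ^+ 5)).
      by rewrite ler_wiXn2l ?invr_ge0 ?invf_le1 ?ler1n// /M; lia.
    by rewrite exprVn; lra.
  have : \sum_(j < N) 4 / 3 * (h j.+1 M + h j M / 2) ^+ 2 <= 2 / 1000 :> R.
    apply: (@le_trans _ _ (\sum_(j < N) (4 / 3 * (9 / 4 * (10 * N%:R)^-1 ^+ 2)))).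
      apply: ler_sum => j _; rewrite ler_wpM2l ?divr_ge0//.
      have := small j.+1 (ltn_ord j); have := small j (ltnW (ltn_ord j)).
      set w := _^-1 => b1 b2; have w0 : 0 <= w by exact: le_trans b1.
      have : `|h j.+1 M + h j M / 2| <= 3 / 2 * w.
        move: b1 b2; rewrite !ler_norml => /andP[? ?] /andP[? ?]; apply/andP; split; lra.
      move=> b3; rewrite -(real_normK (num_real (h j.+1 M + h j M / 2))).
      have := lerXn2r 2 (_ : `|h j.+1 M + h j M / 2| \is Num.nneg) (_ : 3 / 2 * w \is Num.nneg) b3.
      rewrite !nnegrE => HH; have := HH ltac:(done) ltac:(lra); lra.
    rewrite sumr_const card_ord -[leLHS]mulr_natl.
    rewrite [leLHS](_ : _ = 3 / 100 / N%:R); last by field; lra.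
    by rewrite ler_pdivrMr; lra.
  set s := \sum_(_ < _) _; set t := _ ^+ M; lra.
have out : \sum_(k < M | ~~ P k) h N k ^+ 2 <= 126 / 100.
  have b := bessel_h (fun j => if j == N.+1 then 2 * N.+1%:R else if j == N.-1 then 2 * N%:R else 0 : R) N.+2 M.
  have : \sum_(k < M | ~~ P k) (3 * N%:R) ^+ 2 * h N k ^+ 2 <= 16 / 3 * (N.+1%:R ^+ 2 + N%:R ^+ 2).
    apply: (@le_trans _ _ (\sum_(k < M) ((3 * k%:R - 5 * N%:R - 1) * h N k) ^+ 2)).
      rewrite [leRHS](bigID P) /= ler_wpDl ?sumr_ge0//; first by move=> *; exact: sqr_ge0.
      apply: ler_sum => k; rewrite /P => kP; rewrite [leRHS]exprMn ler_wpM2r ?sqr_ge0//.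
      have n3 : 0 <= 3 * N%:R :> R := mulr_ge0 (ler0n _ _) (ler0n _ _).
      rewrite -[leRHS](real_normK (num_real _)); apply: lerXn2r; rewrite ?nnegrE//.
      have /orP[k1|k1] : ((3 * k < 2 * N) || (8 * N < 3 * k))%N by move: kP; lia.
        have : 3 * k%:R + 1 <= 2 * N%:R :> R by rewrite -!natrM natr1 ler_nat.
        by move=> ?; rewrite ler0_norm; lra.
      have : 8 * N%:R + 1 <= 3 * k%:R :> R by rewrite -!natrM natr1 ler_nat.
      by move=> ?; rewrite ger0_norm; lra.
    have sumD (f : nat -> R) : \sum_(j < N.+2) (if j == N.+1 :> nat then 2 * N.+1%:R else if j == N.-1 :> nat then 2 * N%:R else 0) * f j
       = 2 * N%:R * f N.-1 + 2 * N.+1%:R * f N.+1.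
      rewrite big_ord_recr /= eqxx; congr (_ + _).
      have NN : (N.-1 < N.+1)%N by lia.
      rewrite (bigD1 (Ordinal NN)) //= eqxx ifF; last by apply/negbTE/eqP; lia.
      rewrite big1 ?addr0// => i /eqP iN; rewrite ifF; last first.
        by apply/negbTE/eqP; have := ltn_ord i; lia.
      by rewrite ifF ?mul0r//; apply/negbTE/eqP => e; apply: iN; apply: val_inj.
    apply: le_trans (_ : 4 / 3 * (4 * N%:R ^+ 2 + 4 * N.+1%:R ^+ 2) <= _); last lra.
    have -> : 4 * N%:R ^+ 2 + 4 * N.+1%:R ^+ 2 =
      \sum_(j < N.+2) (if j == N.+1 :> nat then 2 * N.+1%:R else if j == N.-1 :> nat then 2 * N%:R else 0) ^+ 2 :> R.
      under eq_bigr do rewrite expr2.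
      rewrite (sumD (fun j => if j == N.+1 then 2 * N.+1%:R else if j == N.-1 then 2 * N%:R else 0)).
      by rewrite !eqxx ifF; [ring|apply/negbTE/eqP; lia].
    apply: le_trans b; rewrite le_eqVlt; apply/orP; left; apply/eqP/eq_bigr => k _.
    congr (_ ^+ 2); rewrite (sumD (fun j => h j k)).
    by have := h_deriv R N k; lra.
  rewrite -mulr_sumr -[N.+1%:R]natr1.
  move: (\sum_(_ < M | _) _) => s H.
  have n0 : 0 < 9 * N%:R ^+ 2 :> R by rewrite mulr_gt0 ?exprn_gt0//; lra.
  rewrite -(ler_pM2l n0).
  have : N%:R * 20 <= N%:R * N%:R :> R by rewrite ler_wpM2l//; lra.
  lra.
move: tot; rewrite (bigID P) /=; lra.
Qed.

End spreading.

(** * Finite convolutions and power means *)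

Section finite_convolution.
Variable R : realFieldType.
Local Notation h := (@blaschke_coef R).
Implicit Types (w x : nat -> R).

Lemma sum_triangle (F : nat -> nat -> R) n :
  \sum_(k < n) \sum_(i < k.+1) F i (k - i)%N = \sum_(i < n) \sum_(j < n - i) F i j.
Proof.
elim: n => [|n IH]; first by rewrite !big_ord0.
rewrite big_ord_recr /= IH [RHS]big_ord_recr /= subSnn big_ord1.
rewrite [X in _ + X]big_ord_recr /= subnn addrA -big_split /=; congr (_ + _).
apply: eq_bigr => i _; have iN := ltn_ord i.
by rewrite (subSn (ltnW iN)) big_ord_recr.
Qed.

Lemma sum_sq_le w x n :
  (\sum_(i < n) w i * x i) ^+ 2 <= (\sum_(i < n) `|w i|) * \sum_(i < n) `|w i| * x i ^+ 2.
Proof.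
set W := \sum_(_ < _) `|_|; set Q := \sum_(i < n) `|w i| * _.
have WQ : W * Q = \sum_(i < n) \sum_(j < n) `|w i| * `|w j| * x j ^+ 2.
  by rewrite /W /Q big_distrlr /=; apply: eq_bigr => i _; apply: eq_bigr => j _; rewrite mulrA.
have QW : W * Q = \sum_(i < n) \sum_(j < n) `|w i| * `|w j| * x i ^+ 2.
  by rewrite mulrC /W /Q big_distrlr /=; apply: eq_bigr => i _; apply: eq_bigr => j _; rewrite mulrAC.
suff : 2 * (\sum_(i < n) w i * x i) ^+ 2 <= W * Q + W * Q by lra.
rewrite {1}WQ QW expr2 big_distrlr /= -big_split mulr_sumr /= ler_sum// => i _.
rewrite -big_split mulr_sumr /= ler_sum// => j _.
have -> : 2 * (w i * x i * (w j * x j)) = (w i * w j) * (2 * (x i * x j)) by ring.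
rewrite -normrM -mulrDr; apply: (le_trans (ler_norm _)).
rewrite [leLHS]normrM ler_wpM2l// ler_norml; apply/andP; split.
  have := sqr_ge0 (x i + x j); lra.
have := sqr_ge0 (x i - x j); lra.
Qed.

Lemma young w x n :
  \sum_(k < n) (\sum_(i < k.+1) w i * x (k - i)%N) ^+ 2 <=
  (\sum_(i < n) `|w i|) ^+ 2 * \sum_(k < n) x k ^+ 2.
Proof.
set W := \sum_(_ < _) `|_|; have W0 : 0 <= W by exact: sumr_ge0.
have sub m (f : nat -> R) : (forall i, 0 <= f i) -> (m <= n)%N ->
    \sum_(i < m) f i <= \sum_(i < n) f i.
  move=> f0 mn; rewrite -(subnKC mn) big_split_ord /= lerDl.
  exact: sumr_ge0.
apply: (@le_trans _ _ (\sum_(k < n) W * \sum_(i < k.+1) `|w i| * x (k - i)%N ^+ 2)).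
  apply: ler_sum => k _; apply: (le_trans (sum_sq_le w (fun i => x (k - i)%N) k.+1)).
  rewrite ler_wpM2r//; first by apply: sumr_ge0 => *; rewrite mulr_ge0 ?sqr_ge0.
  by apply: (sub k.+1 (fun i => `|w i|)).
rewrite -mulr_sumr (sum_triangle (fun i j => `|w i| * x j ^+ 2)) expr2 -mulrA ler_wpM2l//.
rewrite mulr_suml; apply: ler_sum => i _; rewrite -mulr_sumr ler_wpM2l//.
by apply: (sub _ (fun j => x j ^+ 2)) => [j|]; rewrite ?sqr_ge0 ?leq_subr.
Qed.

(** Since 8 (2/3)^6 = 512/729 < 1, the majorant given by [h_decay] is at most 1 at k = 6 N, and its
    ratio 2/3 sums to 3. *)
Lemma h_tail N n : \sum_(6 * N <= k < n) `|h N k| <= 3.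
Proof.
apply: (@le_trans _ _ (\sum_(6 * N <= k < n) 8 ^+ N * (2 / 3) ^+ k)).
  by apply: ler_sum => k _; exact: h_decay.
have [nN|/ltnW Nn] := leqP n (6 * N); first by rewrite big_geq.
have tele : \sum_(6 * N <= k < n) 8 ^+ N * (2 / 3) ^+ k =
   \sum_(6 * N <= k < n) (- 3 * 8 ^+ N * (2 / 3) ^+ k.+1 - - 3 * 8 ^+ N * (2 / 3) ^+ k) :> R.
  by apply: eq_bigr => k _; rewrite exprS; field.
rewrite tele (telescope_sumr (fun k => - 3 * 8 ^+ N * (2 / 3) ^+ k : R))//.
have a0 : 0 <= 8 ^+ N * (2 / 3) ^+ n :> R by rewrite mulr_ge0 ?exprn_ge0 ?divr_ge0.
have a1 : 8 ^+ N * (2 / 3) ^+ (6 * N) <= 1 :> R.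
  have q8 : 0 <= 8 * (2 / 3) ^+ 6 :> R.
    exact: mulr_ge0 (ler0n _ _) (exprn_ge0 _ (divr_ge0 (ler0n _ _) (ler0n _ _))).
  rewrite exprM -exprMn; apply: exprn_ile1 => //.
  have : ((2 / 3) ^+ 2) ^+ 3 <= (1 / 2) ^+ 3 :> R.
    by rewrite lerXn2r ?nnegrE ?divr_ge0 ?exprn_ge0 ?divr_ge0//; lra.
  rewrite -exprM; lra.
rewrite -!mulrA; lra.
Qed.

(** At the outputs L <= k < 2L the first L coefficients see only inputs with indices in [0, 2L).
    There the truncated filter is [hconv] minus the convolution [t] with the tail, so 26 = 2 (4 +
    3^2). *)
Lemma fir_window N x :
  \sum_(i < 6 * N) (\sum_(k < 6 * N) h N k * x (6 * N + i - k)%N) ^+ 2 <=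
  26 * \sum_(j < 6 * N + 6 * N) x j ^+ 2.
Proof.
set L := (6 * N)%N; set X := \sum_(j < L + L) _.
pose w k : R := if (k < L)%N then 0 else h N k.
pose t k := \sum_(i < k.+1) w i * x (k - i)%N.
have tle : \sum_(k < L + L) t k ^+ 2 <= 9 * X.
  apply: (le_trans (young _ _ _)); rewrite ler_wpM2r ?sumr_ge0//; first by move=> *; exact: sqr_ge0.
  have : \sum_(i < L + L) `|w i| <= 3.
    apply: le_trans (h_tail N (L + L)); rewrite -(big_mkord xpredT (fun i => `|w i|)).
    rewrite (@big_cat_nat _ _ _ L) ?leq_addr//= [X in X + _]big_nat big1 ?add0r => [|i /andP[_ iL]].
      by rewrite big_nat [leRHS]big_nat ler_sum// => i /andP[Li _]; rewrite /w ltnNge Li.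
    by rewrite /w iL normr0.
  move=> H; have -> : 9 = 3 ^+ 2 :> R by ring.
  by rewrite lerXn2r ?nnegrE ?sumr_ge0.
have cle := hconv_sum_le N x (L + L).
apply: (@le_trans _ _ (\sum_(k < L + L) (hconv N x k - t k) ^+ 2)).
  rewrite [leRHS]big_split_ord /= ler_wpDl ?sumr_ge0//; first by move=> *; exact: sqr_ge0.
  apply: ler_sum => i _; rewrite le_eqVlt; apply/orP; left; apply/eqP; congr (_ ^+ 2).
  rewrite /hconv /t -sumrB -(big_mkord xpredT (fun k => h N k * x (L + i - k)%N)).
  rewrite -(big_mkord xpredT (fun k => h N k * x (L + i - k)%N - w k * x (L + i - k)%N)).
  rewrite [RHS](@big_cat_nat _ _ _ L) /=; [|by []|by rewrite -addnS leq_addr].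
  rewrite [X in _ = _ + X]big_nat [X in _ = _ + X]big1 ?addr0 => [|k /andP[Lk _]]; last first.
    by rewrite /w ltnNge Lk subrr.
  by rewrite big_nat [RHS]big_nat; apply: eq_bigr => k /andP[_ kL]; rewrite /w kL mul0r subr0.
apply: (@le_trans _ _ (\sum_(k < L + L) (2 * hconv N x k ^+ 2 + 2 * t k ^+ 2))).
  by apply: ler_sum => k _; have := sqr_ge0 (hconv N x k + t k); lra.
rewrite big_split /= -!mulr_sumr; move: cle tle; rewrite -/X.
move: (\sum_(_ < _) _) (\sum_(_ < _) _) => u v; lra.
Qed.

End finite_convolution.

Section power_means.
Variable R : realType.
Implicit Types (s t : nat -> R).

Lemma sum_powR_le_powR_sum s n (r : R) : 1 <= r -> (forall i, 0 <= s i) ->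
  \sum_(i < n) s i `^ r <= (\sum_(i < n) s i) `^ r.
Proof.
move=> r1 s0; elim: n => [|n IH]; first by rewrite !big_ord0 powR_ge0.
rewrite !big_ord_recr /=; set S := \sum_(_ < _) s _.
have S0 : 0 <= S by exact: sumr_ge0.
apply: (le_trans (lerD IH (lexx _))).
have key (a b : R) : 0 <= a -> 0 <= b -> a * (a + b) `^ (r - 1) >= a `^ r.
  move=> a0 b0; rewrite -[a `^ r]mulr_powRB1//; last by rewrite (lt_le_trans ltr01).
  by rewrite ler_wpM2l// ge0_ler_powR ?subr_ge0 ?nnegrE ?lerDl ?addr_ge0//.
have /le_trans : S `^ r + s n `^ r <= S * (S + s n) `^ (r - 1) + s n * (S + s n) `^ (r - 1).
  by rewrite lerD ?key// addrC key.
by apply; rewrite -mulrDl mulr_powRB1 ?addr_ge0//; lra.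
Qed.

Lemma powR_sum_le_sum_powR s n (r : R) : 1 <= r -> (forall i, 0 <= s i) ->
  (\sum_(i < n) s i) `^ r <= n%:R `^ (r - 1) * \sum_(i < n) s i `^ r.
Proof.
move=> r1 s0; case: n => [|n].
  by rewrite !big_ord0 mulr0 powR0//; lra.
set S := \sum_(_ < _) s _; have S0 : 0 <= S by exact: sumr_ge0.
have n0 : 0 < n.+1%:R :> R by rewrite ltr0n.
have [->|r1'] := eqVneq r 1.
  rewrite subrr powRr0 mul1r powRr1//.
  by apply: ler_sum => i _; rewrite powRr1.
have r2 : 1 < r by rewrite lt_def r1'.
(* Young's inequality against m^(r - 1), with m the mean of the s i, is the tangent line of t^r at
   m. *)
pose m := S / n.+1%:R; have m0 : 0 <= m by rewrite divr_ge0// ltW.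
have key i : s i * m `^ (r - 1) <= s i `^ r / r + m `^ r * (r - 1) / r.
  have := @conjugate_powR R (s i) (m `^ (r - 1)) r (r / (r - 1)) (s0 i) (powR_ge0 _ _).
  rewrite -powRrM mulrCA mulfV ?mulr1 ?invf_div; last lra.
  rewrite -mulrA; apply; [lra|rewrite divr_gt0//; lra|by field; lra].
have : \sum_(i < n.+1) s i * m `^ (r - 1) <= \sum_(i < n.+1) (s i `^ r / r + m `^ r * (r - 1) / r).
  by apply: ler_sum => i _; exact: key.
rewrite -mulr_suml big_split /= -mulr_suml sumr_const card_ord -[(m `^ r * (r - 1) / r) *+ _]mulr_natl -/S.
have SE : S = n.+1%:R * m by rewrite /m; field; lra.
have -> : S * m `^ (r - 1) = n.+1%:R * m `^ r.
  by rewrite {1}SE -mulrA mulr_powRB1//; lra.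
move=> H; rewrite SE powRM ?(ltW n0)// -(mulr_powRB1 (ltW n0)); last lra.
rewrite mulrAC [leRHS]mulrC ler_wpM2r ?powR_ge0//.
have rr : 0 < r by lra.
move/(ler_wpM2r (ltW rr)): H; rewrite mulrDl !mulrA divfK ?gt_eqF// divfK ?gt_eqF//.
move: (\sum_(_ < _) _) (n.+1%:R * m `^ r) => u v; lra.
Qed.

(** Applied to squared moduli with r = p/2, it turns an l^2 estimate on a window into an l^p
    estimate. The power mean inequality is paid once, on t if r >= 1 and on s if r < 1; hence the
    exponent |1 - r|. *)
Lemma sum_powR_compare s t n m (K r : R) : 0 < r -> 1 <= K -> (0 < n)%N -> (n <= m)%N ->
  (forall i, 0 <= s i) -> (forall i, 0 <= t i) ->
  \sum_(i < n) s i <= K * \sum_(j < m) t j ->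
  \sum_(i < n) s i `^ r <= K `^ r * m%:R `^ `|1 - r| * \sum_(j < m) t j `^ r.
Proof.
move=> r0 K1 n0 nm s0 t0 st.
have m0 : 0 < m%:R :> R by rewrite ltr0n; lia.
have S0 : 0 <= \sum_(i < n) s i by exact: sumr_ge0.
have T0 : 0 <= \sum_(i < m) t i by exact: sumr_ge0.
have K0 : 0 <= K by lra.
have st' : (\sum_(i < n) s i) `^ r <= K `^ r * (\sum_(j < m) t j) `^ r.
  by rewrite -powRM// ge0_ler_powR ?nnegrE ?mulr_ge0// ltW.
have [r1|r1] := leP 1 r.
  apply: (le_trans (sum_powR_le_powR_sum n r1 s0)); apply: (le_trans st').
  rewrite -mulrA ler_wpM2l ?powR_ge0// ler0_norm ?opprB; last lra.
  exact: powR_sum_le_sum_powR.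
have ri : 1 <= r^-1 by rewrite invf_ge1// ltW.
have rK x : 0 <= x -> (x `^ r) `^ r^-1 = x.
  by move=> x0; rewrite -powRrM mulfV ?gt_eqF// powRr1.
have rK' x : 0 <= x -> (x `^ r^-1) `^ r = x.
  by move=> x0; rewrite -powRrM mulVf ?gt_eqF// powRr1.
have a : \sum_(i < n) s i `^ r <= n%:R `^ (1 - r) * (\sum_(i < n) s i) `^ r.
  have := @powR_sum_le_sum_powR (fun i => s i `^ r) n _ ri (fun i => powR_ge0 _ _).
  under [X in _ <= _ * X]eq_bigr do rewrite rK//.
  move=> H; have A0 : 0 <= \sum_(i < n) s i `^ r by apply: sumr_ge0 => *; exact: powR_ge0.
  have := ge0_ler_powR (ltW r0) _ _ H; rewrite !nnegrE powR_ge0 mulr_ge0 ?powR_ge0// => /(_ isT isT).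
  rewrite rK'// powRM ?powR_ge0// -powRrM mulrBl mulVf ?gt_eqF// mul1r.
  exact.
have b : (\sum_(j < m) t j) `^ r <= \sum_(j < m) t j `^ r.
  have := @sum_powR_le_powR_sum (fun i => t i `^ r) m _ ri (fun i => powR_ge0 _ _).
  under eq_bigr do rewrite rK//.
  move=> H; have A0 : 0 <= \sum_(i < m) t i `^ r by apply: sumr_ge0 => *; exact: powR_ge0.
  have := ge0_ler_powR (ltW r0) _ _ H; rewrite !nnegrE powR_ge0 T0 => /(_ isT isT).
  by rewrite rK'.
apply: (le_trans a).
rewrite (gtr0_norm (x := 1 - r)); last lra.
rewrite mulrAC [leLHS]mulrC ler_pM ?mulr_ge0 ?powR_ge0//.
  by apply: (le_trans st'); rewrite ler_wpM2l ?powR_ge0.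
by rewrite ge0_ler_powR ?nnegrE ?ler_nat//; lra.
Qed.

End power_means.

(** * Limits with explicit error bounds *)

Section limits.
Variable R : realType.

Lemma geometric_small (t c e : R) : 0 <= t -> t < 1 -> 0 < e ->
  exists M, c * t ^+ M <= e.
Proof.
move=> t0 t1 e0; have [c0|c0] := leP c 0.
  by exists 0%N; rewrite expr0 mulr1 (le_trans c0)// ltW.
have [->|tn0] := eqVneq t 0; first by exists 1%N; rewrite expr1 mulr0 ltW.
have tp : 0 < t by rewrite lt_def tn0.
pose d := t^-1 - 1; have d0 : 0 < d by rewrite subr_gt0 invf_gt1.
have bern M : M%:R * d <= t^-1 ^+ M.
  suff : 1 + M%:R * d <= t^-1 ^+ M by lra.
  have -> : t^-1 = 1 + d by rewrite /d addrC subrK.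
  elim: M => [|M IH]; first by rewrite expr0 mul0r addr0.
  rewrite exprS -natr1.
  have := ler_wpM2l (ltW (addr_gt0 ltr01 d0)) IH.
  have := mulr_ge0 (mulr_ge0 (ler0n R M) (ltW d0)) (ltW d0); lra.
have [M HM] : exists M, c / e / d < M%:R.
  by exists (Num.bound (c / e / d)); rewrite archi_boundP// !divr_ge0// ltW.
exists M; have tM : 0 < t ^+ M by rewrite exprn_gt0.
rewrite -ler_pdivlMr// -exprVn -ler_pdivrMl// mulrC.
apply: le_trans (bern M); rewrite -ler_pdivrMr//; exact: ltW.
Qed.

Lemma le_of_geometric (a b c : R) : (forall M, a <= b + c * (2 / 3) ^+ M) -> a <= b.
Proof.
move=> H; apply/ler_addgt0Pr => e e0.
have [||M HM] := @geometric_small (2 / 3) c e _ _ e0; [lra|lra|].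
by apply: (le_trans (H M)); rewrite lerD2l.
Qed.

(** The intervals [u M - e M, u M + e M] meet pairwise, so the supremum of their left ends belongs
    to all of them. *)
Lemma ex_limit (u e : nat -> R) : (forall M n, `|u (M + n)%N - u M| <= e M) ->
  exists l, forall M, `|l - u M| <= e M.
Proof.
move=> H.
have e0 M : 0 <= e M by exact: le_trans (H M 0%N).
have cmp M N : u M - e M <= u N + e N.
  have [le|/ltnW le] := leqP M N.
    have := H M (N - M)%N; rewrite subnKC// => /ler_normlP[]; have := e0 N; lra.
  have := H N (M - N)%N; rewrite subnKC// => /ler_normlP[]; have := e0 M; lra.
pose A : set R := [set u M - e M | M in setT]%classic.
have A0 : (A !=set0)%classic by exists (u 0%N - e 0%N); exists 0%N.
have ub M : classical_sets.ubound A (u M + e M) by move=> _ [N _ <-]; exact: cmp.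
exists (sup A) => M; rewrite ler_norml; apply/andP; split.
  have : u M - e M <= sup A by apply: ub_le_sup; [exists (u 0%N + e 0%N); exact: ub|exists M].
  lra.
have : sup A <= u M + e M by apply: ge_sup.
lra.
Qed.

End limits.

(** * Complex coefficients *)

Section complex_facts.
Variable R : realType.
Implicit Types (z w : R[i]).

Lemma normc_real (a : R) : normc a%:C%C = `|a|.
Proof. by rewrite /= expr0n addr0 sqrtr_sqr. Qed.

Lemma normc_le_ReIm z : normc z <= `|complex.Re z| + `|complex.Im z|.
Proof.
case: z => a b /=; rewrite -(@ler_pXn2r _ 2) ?nnegrE ?sqrtr_ge0 ?addr_ge0//.
rewrite sqr_sqrtr ?addr_ge0 ?sqr_ge0// -(real_normK (num_real a)) -(real_normK (num_real b)).
have := mulr_ge0 (normr_ge0 a) (normr_ge0 b); lra.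
Qed.

Lemma Re_le_normc z : `|complex.Re z| <= normc z.
Proof.
case: z => a b /=; rewrite -(@ler_pXn2r _ 2) ?nnegrE ?sqrtr_ge0//.
by rewrite sqr_sqrtr ?addr_ge0 ?sqr_ge0// (real_normK (num_real a)) lerDl sqr_ge0.
Qed.

Lemma Im_le_normc z : `|complex.Im z| <= normc z.
Proof.
case: z => a b /=; rewrite -(@ler_pXn2r _ 2) ?nnegrE ?sqrtr_ge0//.
by rewrite sqr_sqrtr ?addr_ge0 ?sqr_ge0// (real_normK (num_real b)) lerDr sqr_ge0.
Qed.

Lemma normcX z n : normc (z ^+ n) = normc z ^+ n.
Proof.
elim: n => [|n IH]; first by rewrite !expr0 (_ : 1 = 1%:C%C)// normc_real normr1.
by rewrite !exprS normcM IH.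
Qed.

Lemma normc_sq z : normc z ^+ 2 = complex.Re z ^+ 2 + complex.Im z ^+ 2.
Proof. by case: z => a b; rewrite /= sqr_sqrtr ?addr_ge0 ?sqr_ge0. Qed.

Lemma ReZ (a : R) z : complex.Re (a%:C%C * z) = a * complex.Re z.
Proof. by case: z => x y /=; rewrite mul0r subr0. Qed.

Lemma ImZ (a : R) z : complex.Im (a%:C%C * z) = a * complex.Im z.
Proof. by case: z => x y /=; rewrite mul0r addr0. Qed.

Lemma Re_sum I (r : seq I) (F : I -> R[i]) :
  complex.Re (\sum_(i <- r) F i) = \sum_(i <- r) complex.Re (F i).
Proof. exact: (raddf_sum (@complex.Re R)). Qed.

Lemma Im_sum I (r : seq I) (F : I -> R[i]) :
  complex.Im (\sum_(i <- r) F i) = \sum_(i <- r) complex.Im (F i).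
Proof. exact: (raddf_sum (@complex.Im R)). Qed.

Lemma unimodular_recurrence (w : R[i]) j : normc w = 1 ->
  w ^+ j.+2 * w^-1 + w ^+ j * w^-1 = (2 * complex.Re w)%:C%C * (w ^+ j.+1 * w^-1).
Proof.
move=> w1; have w0 : w != 0 by apply/eqP => e; move: w1; rewrite e normc0; lra.
have e : w * w + 1 = (2 * complex.Re w)%:C%C * w.
  have := normc_sq w; rewrite w1 expr1n; case: w {w1 w0} => a b /= H.
  by apply/eqP; rewrite eq_complex /= ; apply/andP; split; apply/eqP; lra.
rewrite -mulrDl mulrA; congr (_ * _); rewrite !exprS; move: (w ^+ j) => u.
by rewrite [X in _ = X]mulrA -e; ring.
Qed.

Lemma packet_l1_complex (w : R[i]) m M : normc w = 1 ->
  \sum_(k < M) normc (\sum_(j < m.*2.+1) ((bpmf R m j)%:C%C * w ^+ j) * (blaschke_coef R j k)%:C%C) <= 80.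
Proof.
move=> w1; have w0 : w != 0 by apply/eqP => e; move: w1; rewrite e normc0; lra.
pose s : R := Num.sqrt m.*2.+1%:R.
have s1 : 1 <= s by rewrite -sqrtr1 ler_wsqrtr// ler1n.
have s2 : s ^+ 2 = m.*2.+1%:R by rewrite sqr_sqrtr.
pose z j : R[i] := w ^+ j * w^-1.
have z1 j : normc (z j) <= 1.
  have iw : normc w^-1 = 1.
    have : normc (w * w^-1) = 1 by rewrite divff// (_ : 1 = 1%:C%C)// normc_real normr1.
    by rewrite normcM w1 mul1r.
  by rewrite /z normcM normcX w1 iw expr1n mul1r.
have zS j : z j.+2 + z j = (2 * complex.Re w)%:C%C * z j.+1 by exact: unimodular_recurrence.
have zRe j : complex.Re (z j.+2) + complex.Re (z j) = 2 * complex.Re w * complex.Re (z j.+1).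
  by rewrite -ReZ -zS raddfD.
have zIm j : complex.Im (z j.+2) + complex.Im (z j) = 2 * complex.Re w * complex.Im (z j.+1).
  by rewrite -ImZ -zS raddfD.
have re := @packet_l1 R (fun j => complex.Re (z j)) (complex.Re w) s m
  (fun j => le_trans (Re_le_normc _) (z1 j))
  zRe s1 s2 M.
have im := @packet_l1 R (fun j => complex.Im (z j)) (complex.Re w) s m
  (fun j => le_trans (Im_le_normc _) (z1 j))
  zIm s1 s2 M.
have -> : 80 = 40 + 40 :> R by ring.
apply: le_trans (lerD re im); rewrite -big_split; apply: ler_sum => k _ /=.
have zw j : z j.+1 = w ^+ j by rewrite /z exprSr mulfK.
apply: le_trans (normc_le_ReIm _) _; rewrite Re_sum Im_sum.
have eR (j : nat) : complex.Re ((bpmf R m j)%:C%C * w ^+ j * (blaschke_coef R j k)%:C%C) =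
    bpmf R m j * complex.Re (z j.+1) * blaschke_coef R j k.
  by rewrite zw mulrC mulrA -rmorphM ReZ; ring.
have eI (j : nat) : complex.Im ((bpmf R m j)%:C%C * w ^+ j * (blaschke_coef R j k)%:C%C) =
    bpmf R m j * complex.Im (z j.+1) * blaschke_coef R j k.
  by rewrite zw mulrC mulrA -rmorphM ImZ; ring.
by rewrite (eq_bigr _ (fun (j : 'I_m.*2.+1) _ => eR j)) (eq_bigr _ (fun (j : 'I_m.*2.+1) _ => eI j)).
Qed.

End complex_facts.

(** * Operators on the sequence spaces *)

Local Open Scope classical_set_scope.
Local Open Scope ring_scope.

Section ellnorm_facts.
Variable R : realType.
Implicit Types (x y : int -> R[i]) (p : \bar R) (A : set int).

Lemma esum_shift (f : int -> \bar R) (n : int) :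
  (\esum_(k in setT) f (k + n)%R = \esum_(k in setT) f k)%E.
Proof.
symmetry; apply: reindex_esum; split=> //.
- by move=> a b _ _ /addIr.
- by move=> k _; exists (k - n) => //; rewrite subrK.
Qed.

Lemma ellnorm_powR (r : R) x : 0 < r ->
  (ellnorm r%:E x `^ r = \esum_(k in setT) (normc (x k) `^ r)%:E)%E.
Proof.
move=> r0; rewrite ellnorm_fin -poweRrM mulVf ?gt_eqF// poweRe1//.
by apply: esum_ge0 => k _; rewrite lee_fin powR_ge0.
Qed.

Lemma ellnorm_leP (r B : R) x : 0 < r -> 0 <= B ->
  (ellnorm r%:E x <= B%:E)%E = (\esum_(k in setT) (normc (x k) `^ r)%:E <= (B `^ r)%:E)%E.
Proof.
move=> r0 B0; rewrite -ellnorm_powR// -poweR_EFin; apply/idP/idP => H.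
  apply: gt0_ler_poweR => //; first exact: ltW.
    by rewrite in_itv /= leey ellnorm_ge0.
  by rewrite in_itv /= leey lee_fin B0.
have r1 : 0 <= r^-1 by rewrite invr_ge0 ltW.
have := gt0_ler_poweR r1 _ _ H.
rewrite !in_itv /= !leey !andbT poweR_ge0 lee_fin powR_ge0 => /(_ isT isT).
by rewrite -poweRrM mulfV ?gt_eqF// poweRe1 ?ellnorm_ge0// -powRrM mulfV ?gt_eqF// powRr1.
Qed.

Lemma le_ellnorm p x y : (1 <= p)%E -> (forall k, normc (x k) <= normc (y k)) ->
  (ellnorm p x <= ellnorm p y)%E.
Proof.
case: p => [r r1 xy|_ xy|//].
  have r0 : 0 < r by rewrite (lt_le_trans ltr01).
  rewrite !ellnorm_fin; apply: gt0_ler_poweR.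
  - by rewrite invr_ge0 ltW.
  - by rewrite in_itv /= leey esum_ge0// => k _; rewrite lee_fin powR_ge0.
  - by rewrite in_itv /= leey esum_ge0// => k _; rewrite lee_fin powR_ge0.
  apply: le_esum => k _; rewrite lee_fin.
  by rewrite ge0_ler_powR ?nnegrE ?normc_ge0// ltW.
rewrite !ellnorm_infty; apply: ge_ereal_sup => _ [k _ <-].
by apply: (@le_trans _ _ (normc (y k))%:E); [rewrite lee_fin|apply: ereal_sup_ubound; exists k].
Qed.

Lemma ellnorm_shift p (n : int) x : (1 <= p)%E ->
  ellnorm p (fun k => x (k + n)) = ellnorm p x.
Proof.
case: p => [r _|_|//].
  by rewrite !ellnorm_fin (esum_shift (fun k => (normc (x k) `^ r)%:E)).
rewrite !ellnorm_infty; congr ereal_sup; apply/seteqP; split => _ [k _ <-].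
  by exists (k + n).
by exists (k - n) => //; rewrite subrK.
Qed.

Definition restr A x : int -> R[i] := fun k => if k \in A then x k else 0.

Lemma ellnorm_le_restr p x (B : R) : (1 <= p)%E -> 0 <= B ->
  (forall A, finite_set A -> (ellnorm p (restr A x) <= B%:E)%E) ->
  (ellnorm p x <= B%:E)%E.
Proof.
case: p => [r r1 B0 H|_ B0 H|//].
  have r0 : 0 < r by rewrite (lt_le_trans ltr01).
  rewrite ellnorm_leP//; apply: ge_ereal_sup => _ [A [finA _] <-].
  have := H A finA; rewrite ellnorm_leP//; apply: le_trans.
  apply: esum_ge; exists A; first by split.
  apply: lee_fsum => // k Ak; rewrite /restr ifT//; exact/mem_set.
rewrite ellnorm_infty; apply: ge_ereal_sup => _ [k _ <-].
have := H [set k] (finite_set1 k); apply: le_trans.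
rewrite ellnorm_infty; apply: ereal_sup_ubound; exists k => //.
by rewrite /restr ifT// inE.
Qed.

Lemma ellnorm_restr_cst p A (c : R[i]) : (1 <= p)%E -> finite_set A ->
  (ellnorm p (restr A (cst c)) < +oo)%E.
Proof.
move=> p1 finA; case: p p1 => [r r1|_|//].
  rewrite -[ltLHS]poweRe1 ?ellnorm_ge0//.
  have r0 : 0 < r by rewrite (lt_le_trans ltr01).
  rewrite -(@mulfV _ r) ?gt_eqF// poweRrM ellnorm_powR//; apply: poweR_lty.
  rewrite (eq_esum (b := fun k => if k \in A then (normc c `^ r)%:E else 0%E)); last first.
    move=> k _; rewrite /restr; case: ifP => // _.
    by rewrite normc0 powR0 ?gt_eqF.
  rewrite -esum_mkcond esum_fset// ?fsbig_finite//=.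
    by rewrite sumEFin ltry.
  by move=> *; rewrite lee_fin powR_ge0.
apply: (@le_lt_trans _ _ (normc c)%:E); last exact: ltry.
rewrite ellnorm_infty; apply: ge_ereal_sup => _ [k _ <-]; rewrite lee_fin /restr.
by case: ifP; rewrite // normc0 normc_ge0.
Qed.

(** On a finite set A a uniform error e costs at most e times the norm of the indicator of A.
    Letting e tend to 0 for each A, and only then A grow, treats all p at once. *)
Lemma ellnorm_lim p x (y : nat -> int -> R[i]) (B : R) : (1 <= p)%E -> 0 <= B ->
  (forall M, (ellnorm p (y M) <= B%:E)%E) ->
  (forall e, 0 < e -> exists M, forall k, normc (x k - y M k) <= e) ->
  (ellnorm p x <= B%:E)%E.
Proof.
move=> p1 B0 yB xy; apply: ellnorm_le_restr => // A finA.
have := ellnorm_restr_cst 1 p1 finA; set m := ellnorm _ _ => mfin.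
have m0 : (0 <= m)%E by exact: ellnorm_ge0.
have mE : m = (fine m)%:E by rewrite fineK// ge0_fin_numE.
have fm0 : 0 <= fine m by exact: fine_ge0.
have H e : 0 < e -> (ellnorm p (restr A x) <= (B + e * (fine m))%:E)%E.
  move=> e0; have [M HM] := xy e e0.
  have -> : restr A x = (restr A (y M) + restr A (fun k => x k - y M k))%R.
    apply/funext => k; rewrite /restr /= fctE /=; case: ifP => _; first by rewrite addrC subrK.
    by rewrite addr0.
  apply: (le_trans (ellnormD _ _ p1)); rewrite EFinD leeD//.
    apply: le_trans (yB M); apply: le_ellnorm => // k; rewrite /restr.
    by case: ifP => // _; rewrite normc0 normc_ge0.
  rewrite EFinM -mE -[e](ger0_norm (ltW e0)) -normc_real -ellnormZ//.
  apply: le_ellnorm => // k; rewrite /restr /= fctE /=; case: ifP => _; last by rewrite scaler0.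
  by rewrite normcM normc_real (_ : 1 = 1%:C%C)// normc_real normr1 mulr1 (ger0_norm (ltW e0)).
apply/lee_addgt0Pr => e e0; have := H (e / (fine m + 1)) (divr_gt0 e0 (ltr_pwDr ltr01 fm0)).
move=> /le_trans; apply; rewrite -EFinD lee_fin lerD2l -mulrA ler_piMr ?(ltW e0)//.
by rewrite mulrC ler_pdivrMr ?mul1r ?lerDl// ltr_pwDr.
Qed.

Lemma ex_limit_complex (u : nat -> R[i]) (e : nat -> R) :
  (forall M n, normc (u (M + n)%N - u M) <= e M) ->
  exists l, forall M, normc (l - u M) <= 2 * e M.
Proof.
move=> H.
have [|a Ha] := @ex_limit R (fun M => complex.Re (u M)) e.
  by move=> M n; apply: le_trans (H M n); rewrite -raddfB; exact: Re_le_normc.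
have [|b Hb] := @ex_limit R (fun M => complex.Im (u M)) e.
  by move=> M n; apply: le_trans (H M n); rewrite -raddfB; exact: Im_le_normc.
exists (a +i* b)%C => M; apply: (le_trans (normc_le_ReIm _)).
by rewrite !raddfB /= mulr_natl mulr2n lerD.
Qed.

End ellnorm_facts.

Section ell_operators.
Variables (R : realType) (p : \bar R) (p1 : (1 <= p)%E).
Local Notation X := (ell R p1).
Implicit Types (x y : X) (k : int) (q : R[i]).

Definition nr x : R := fine (ellnorm p x).

Lemma nrE x : ellnorm p x = (nr x)%:E. Proof. by rewrite fine_ellnorm. Qed.

Lemma nr_ge0 x : 0 <= nr x.
Proof. by rewrite -lee_fin -nrE ellnorm_ge0. Qed.

Lemma nrD x y : nr (x + y) <= nr x + nr y.
Proof. by rewrite -lee_fin EFinD -!nrE; exact: ellnormD. Qed.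

Lemma nrZ (a : R[i]) x : nr (a *: x) = normc a * nr x.
Proof. by apply: EFin_inj; rewrite EFinM -!nrE; exact: ellnormZ. Qed.

Lemma nr0 : nr 0 = 0.
Proof. by rewrite -(scale0r 0) nrZ normc0 mul0r. Qed.

Lemma nrN x : nr (- x) = nr x.
Proof. by rewrite -scaleN1r nrZ normcN normc1 mul1r. Qed.

Lemma nrB x y : nr (x - y) <= nr x + nr y.
Proof. by rewrite -[nr y]nrN nrD. Qed.

Lemma nr_sum n (F : nat -> X) : nr (\sum_(i < n) F i) <= \sum_(i < n) nr (F i).
Proof.
elim: n => [|n IH]; first by rewrite !big_ord0 nr0.
by rewrite !big_ord_recr /= (le_trans (nrD _ _))// lerD2r.
Qed.

Lemma normc_le_nr x k : normc (x k) <= nr x.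
Proof. by rewrite -lee_fin -nrE normc_le_ellnorm. Qed.

Lemma ell_ext x y : (forall k, x k = y k) -> x = y.
Proof. by move=> xy; apply/val_inj/funext. Qed.

Lemma ellN x k : (- x) k = - x k. Proof. by []. Qed.

Lemma ell_sum n (F : nat -> X) k : (\sum_(i < n) F i) k = \sum_(i < n) F i k.
Proof.
elim: n => [|n IH]; first by rewrite !big_ord0.
by rewrite !big_ord_recr /= -IH.
Qed.

Definition ellE := (ellN, @ell_valD R p p1, @ell_valZ R p p1).

Lemma shift_subproof x : (fun k => x (k - 1)) \in ell_pred p.
Proof. by rewrite inE /= ellnorm_shift ?ellP. Qed.

Definition shift x : X := Ell p1 (shift_subproof x).

Lemma shift_linear : linear shift.
Proof. by move=> a x y; apply: ell_ext. Qed.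

HB.instance Definition _ := GRing.isLinear.Build R[i] X X _ shift shift_linear.

Lemma shiftE x k : shift x k = x (k - 1). Proof. by []. Qed.

Lemma nr_shift x : nr (shift x) = nr x.
Proof. by apply: EFin_inj; rewrite -!nrE /= ellnorm_shift. Qed.

Lemma nr_iter_shift n x : nr (iter n shift x) = nr x.
Proof. by elim: n => [//|n IH]; rewrite iterS nr_shift. Qed.

Lemma iter_shiftE n x k : iter n shift x k = x (k - n%:Z).
Proof.
elim: n k => [|n IH] k; first by rewrite subr0.
by rewrite iterS shiftE IH -addn1 PoszD opprD addrA addrAC.
Qed.

(** The shift is isometric and |q| < 1. Identities between rational functions of the shift are
    checked by multiplying with such a factor, after which they are polynomial. *)
Lemma shift_inj q x y : normc q < 1 ->
  x - q *: shift x = y - q *: shift y -> x = y.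
Proof.
move=> q1 e; apply/eqP; rewrite -subr_eq0; apply/eqP.
have d : x - y = q *: shift (x - y).
  apply: ell_ext => k; have := congr1 (fun z : X => z k) e; rewrite !(ellE, shiftE) => ek.
  have -> : x k - y k = x k - q * x (k - 1) - y k + q * x (k - 1) by ring.
  by rewrite ek; ring.
have : nr (x - y) = 0.
  have := congr1 nr d; rewrite nrZ nr_shift => /eqP.
  rewrite -subr_eq0 -{1}[nr _]mul1r -mulrBl mulf_eq0 subr_eq0 => /orP[/eqP q2|/eqP//].
  by move: q1; rewrite -q2 ltxx.
by move=> z; apply: ell_norm_eq0; rewrite /ell_norm -/(nr _) z.
Qed.

Lemma sum_geometric_le (t : R) n : 0 <= t -> t < 1 -> \sum_(i < n) t ^+ i <= (1 - t)^-1.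
Proof.
move=> t0 t1; have t2 : 0 < 1 - t by rewrite subr_gt0.
rewrite -[leRHS]mul1r ler_pdivlMr// mulrC -opprB mulNr -subrX1 opprB.
by rewrite gerBl exprn_ge0.
Qed.

Definition geo_sum q x n := \sum_(j < n) q ^+ j *: iter j shift (shift x).

Lemma nr_geo_sum q x n m : normc q < 1 ->
  nr (\sum_(j < n) q ^+ (m + j) *: iter (m + j) shift (shift x)) <=
  normc q ^+ m * (nr x / (1 - normc q)).
Proof.
move=> q1; apply: (le_trans (nr_sum _ (fun j => q ^+ (m + j) *: iter (m + j) shift (shift x)))).
under eq_bigr do rewrite nrZ normcX nr_iter_shift nr_shift exprD -mulrA.
rewrite -mulr_sumr ler_wpM2l ?exprn_ge0 ?normc_ge0//.
rewrite -mulr_suml mulrC ler_wpM2l ?nr_ge0//.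
by rewrite sum_geometric_le ?normc_ge0.
Qed.

Lemma geo_sumS q x n : geo_sum q x n.+1 = shift x + q *: shift (geo_sum q x n).
Proof.
rewrite /geo_sum big_ord_recl /= expr0 scale1r; congr (_ + _).
rewrite linear_sum /= scaler_sumr; apply: eq_bigr => j _.
by rewrite linearZ /= scalerA -exprS.
Qed.

(** The Neumann series is summed coordinate by coordinate, and [ellnorm_lim] puts the sum back into
    the space. *)
Lemma geo_ex q x : normc q < 1 -> exists y, y - q *: shift y = shift x.
Proof.
move=> q1; have q0 := normc_ge0 q.
pose e (M : nat) : R := normc q ^+ M * (nr x / (1 - normc q)).
have lim k : exists l, forall M, normc (l - geo_sum q x M k) <= 2 * e M.
  apply: ex_limit_complex => M n; apply: le_trans (nr_geo_sum x n M q1).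
  apply: le_trans (normc_le_nr _ k); rewrite le_eqVlt; apply/orP; left; apply/eqP.
  congr normc; rewrite -[LHS]/((geo_sum q x (M + n) - geo_sum q x M) k).
  congr (ell_val _ k); rewrite /geo_sum big_split_ord /=.
  by rewrite [X in X - _]addrC addrK.
have [y0 Hy] := boolp.choice lim.
have eM (d : R) : 0 < d -> exists M, 2 * e M <= d.
  move=> d0; have [M HM] := @geometric_small R (normc q) (2 * (nr x / (1 - normc q))) d q0 q1 d0.
  by exists M; rewrite /e mulrCA mulrC.
have yell : y0 \in ell_pred p.
  rewrite inE /=; apply: (@le_lt_trans _ _ (nr x / (1 - normc q))%:E); last exact: ltry.
  apply: (@ellnorm_lim R p y0 (fun M => geo_sum q x M)) => //.
  - by rewrite divr_ge0 ?nr_ge0// subr_ge0 ltW.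
  - move=> M; rewrite nrE lee_fin.
    by have := nr_geo_sum x M 0 q1; rewrite expr0 mul1r.
  - move=> d /eM[M HM]; exists M => k; exact: le_trans (Hy k M) HM.
exists (Ell p1 yell); apply: ell_ext => k; rewrite !ellE !shiftE /=.
apply/eqP; rewrite -subr_eq0; apply/eqP/eq0_normc/eqP.
rewrite eq_le normc_ge0 andbT; apply/ler_addgt0Pr => d d0; rewrite add0r.
have [M HM] := eM (d / 2) (divr_gt0 d0 (ltr0Sn _ 1)).
have -> : y0 k - q * y0 (k - 1) - x (k - 1) =
  (y0 k - geo_sum q x M.+1 k) + - q * (y0 (k - 1) - geo_sum q x M (k - 1)).
  by rewrite geo_sumS !ellE !shiftE; ring.
apply: (le_trans (le_normcD _ _)); rewrite normcM.
have e1 : e M.+1 <= e M.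
  rewrite /e exprS -mulrA ler_piMl//; last exact: ltW.
  by rewrite mulr_ge0 ?exprn_ge0 ?divr_ge0 ?nr_ge0// subr_ge0 ltW.
rewrite normcN.
have h1 := Hy k M.+1; have h2 := Hy (k - 1) M.
have h3 : normc q * normc (y0 (k - 1) - geo_sum q x M (k - 1)) <= 2 * e M.
  by apply: le_trans h2; rewrite ler_piMl ?normc_ge0// ltW.
move: h1 h3 HM; move: (normc _) (normc q * _) => a b; lra.
Qed.

Definition geo q (q1 : normc q < 1) x : X := projT1 (cid (geo_ex x q1)).

Lemma geo_eq q (q1 : normc q < 1) x : geo q1 x - q *: shift (geo q1 x) = shift x.
Proof. by rewrite /geo; case: cid. Qed.

Lemma geoE q (q1 : normc q < 1) x k : geo q1 x k = x (k - 1) + q * geo q1 x (k - 1).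
Proof.
have /(congr1 (fun z : X => z k)) := geo_eq q1 x; rewrite !ellE !shiftE => <-.
by rewrite subrK.
Qed.

(* Power series [c + d (s + q s^2 + q^2 s^3 + ...)] evaluated at the shift. *)
Definition mob (c d : R[i]) q (q1 : normc q < 1) x : X := c *: x + d *: geo q1 x.

Lemma mob_linear c d q (q1 : normc q < 1) : linear (mob c d q1).
Proof.
move=> a x y; have geoD : geo q1 (a *: x + y) = a *: geo q1 x + geo q1 y.
  apply: (@shift_inj q) => //; rewrite geo_eq; apply: ell_ext => k.
  by rewrite !ellE !shiftE !ellE !(geoE _ _ k); ring.
by apply: ell_ext => k; rewrite /mob geoD !ellE; ring.
Qed.

HB.instance Definition _ c d q (q1 : normc q < 1) :=
  GRing.isLinear.Build R[i] X X _ (mob c d q1) (mob_linear c d q1).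

Lemma mobE c d q (q1 : normc q < 1) x :
  mob c d q1 x - q *: shift (mob c d q1 x) = c *: x + (d - q * c) *: shift x.
Proof.
by apply: ell_ext => k; rewrite /mob !(ellE, shiftE) (geoE _ _ k); ring.
Qed.

End ell_operators.

Lemma normc_half (R : realType) : normc (2^-1 : R)%:C%C < 1.
Proof. by rewrite normc_real ger0_norm ?invr_ge0// invf_lt1 ?ltr1n. Qed.

(** * The Blaschke operator and polynomials in it *)

Section blaschke.
Variables (R : realType) (p : \bar R) (p1 : (1 <= p)%E).
Local Notation X := (ell R p1).
Local Notation h := (blaschke_coef R).
Local Notation half := ((2^-1 : R)%:C%C).
Implicit Types (x y : X) (k : int) (w : R[i]).

Lemma blaschke_ex : exists V : {linear X -> X}, forall x k,
  V x k = half * V x (k - 1) + x (k - 1) - half * x k.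
Proof.
(* The expansion is (s - 1/2)/(1 - s/2) = -1/2 + (3/4)(s + s^2/2 + ...). *)
exists (mob (- half) ((3 / 4 : R)%:C%C) (normc_half R)) => x k.
have := congr1 (fun z : X => z k) (mobE (- half) ((3 / 4 : R)%:C%C) (normc_half R) x).
have -> : (3 / 4 : R)%:C%C - half * - half = 1 :> R[i].
  by rewrite -rmorphN -rmorphM -rmorphB (_ : 1 = 1%:C%C)//; congr (_%:C)%C; field.
rewrite [LHS]ellE ellN ell_valZ shiftE => /eqP; rewrite subr_eq => /eqP ->.
by rewrite !(ellE, shiftE); ring.
Qed.

(* The Blaschke factor [(s - 1/2) / (1 - s/2)] of the shift. *)
Definition blaschke : {linear X -> X} := projT1 (cid blaschke_ex).

Lemma blaschkeE x k :
  blaschke x k = half * blaschke x (k - 1) + x (k - 1) - half * x k.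
Proof. by rewrite /blaschke; case: cid. Qed.

Let nr_half x : nr (half *: x) = nr x / 2.
Proof. by rewrite nrZ normc_real ger0_norm ?invr_ge0// mulrC. Qed.

Lemma nr_blaschke x : nr (blaschke x) <= 3 * nr x.
Proof.
have e : blaschke x = (half *: shift (blaschke x) + shift x) - half *: x.
  by apply: ell_ext => k; rewrite !(ellE, shiftE) blaschkeE.
have := nrB (half *: shift (blaschke x) + shift x) (half *: x).
have := nrD (half *: shift (blaschke x)) (shift x).
rewrite -e !nr_half !nr_shift; lra.
Qed.

(** Multiplication by 1 - s/2, which cancels the denominator carried by [h]: formally V^j is
    [comp_half] of the series with coefficients [h j]. *)
Definition comp_half x := x - half *: shift x.

Lemma nr_comp_half_le x : nr (comp_half x) <= 3 / 2 * nr x.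
Proof. by have := nrB x (half *: shift x); rewrite nr_half nr_shift; lra. Qed.

Lemma nr_comp_half_ge x : nr x / 2 <= nr (comp_half x).
Proof.
have := nrD (comp_half x) (half *: shift x); rewrite subrK nr_half nr_shift; lra.
Qed.

Lemma blaschke_shift x : blaschke (shift x) = shift (blaschke x).
Proof.
apply: (shift_inj (normc_half R)); apply: ell_ext => k.
by rewrite !(ellE, shiftE) (blaschkeE (shift x) k) (blaschkeE x (k - 1)) !shiftE; ring.
Qed.

Lemma blaschke_comp_half x : blaschke (comp_half x) = shift x - half *: x.
Proof.
rewrite /comp_half linearB linearZ /= blaschke_shift; apply: ell_ext => k.
by rewrite !(ellE, shiftE) (blaschkeE _ k); ring.
Qed.

Definition partial_h j M x : X := \sum_(i < M) (h j i)%:C%C *: iter i (@shift R p p1) x.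

Lemma partial_hE j M x k : partial_h j M x k = \sum_(i < M) (h j i)%:C%C * x (k - i%:Z).
Proof. by rewrite /partial_h (ell_sum M (fun i => (h j i)%:C%C *: iter i (@shift R p p1) x)); apply: eq_bigr => i _; rewrite ell_valZ iter_shiftE. Qed.

(** For the full series the left side would vanish, by [hSS]. Truncation leaves one monomial, which
    [h_decay] makes geometrically small in M. *)
Lemma partial_h_step j M x :
  shift (partial_h j M.+1 x) - half *: partial_h j M.+1 x - comp_half (partial_h j.+1 M.+1 x)
  = (h j M + h j.+1 M / 2)%:C%C *: iter M.+1 (@shift R p p1) x.
Proof.
rewrite /comp_half; apply: ell_ext => k; rewrite !ellE iter_shiftE !(ellE, shiftE).
elim: M => [|M IH].
  by rewrite !partial_hE !big_ord1 !subr0 hS0 !(rmorphD, rmorphM, rmorphN) /=; ring.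
have split_h i l : partial_h i M.+2 x l = partial_h i M.+1 x l + (h i M.+1)%:C%C * x (l - M.+1%:Z).
  by rewrite !partial_hE big_ord_recr.
have km : k - 1 - M.+1%:Z = k - M.+2%:Z by rewrite -[M.+2]addn1 PoszD opprD addrA addrAC.
rewrite !split_h km -[LHS]addr0.
have := IH; move: (partial_h j M.+1 x (k - 1)) (partial_h j M.+1 x k).
move: (partial_h j.+1 M.+1 x k) (partial_h j.+1 M.+1 x (k - 1)) => c d a b e; rewrite hSS !(rmorphD, rmorphM, rmorphN, rmorphB) /=.
have -> : a = half * b + (c - half * d) + (h j M + h j.+1 M / 2)%:C%C * x (k - M.+1%:Z).
  by rewrite -e; ring.
by rewrite !(rmorphD, rmorphM, rmorphN, rmorphB) /=; ring.
Qed.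

Lemma blaschke_approx j : exists2 c : R, 0 <= c & forall x M,
  nr (iter j blaschke x - comp_half (partial_h j M.+1 x)) <= c * (2 / 3) ^+ M * nr x.
Proof.
elim: j => [|j [c c0 IH]].
  exists 1 => // x M; rewrite mul1r.
  have -> : iter 0 blaschke x - comp_half (partial_h 0 M.+1 x) =
      (2^-1 ^+ M.+1)%:C%C *: iter M.+1 (@shift R p p1) x.
    rewrite /comp_half; apply: ell_ext => k; rewrite !ellE iter_shiftE !(ellE, shiftE).
    elim: M => [|M IHM].
      by rewrite !partial_hE !big_ord1 !subr0 h0 expr0 expr1; ring.
    have split_h l : partial_h 0 M.+2 x l = partial_h 0 M.+1 x l + (h 0 M.+1)%:C%C * x (l - M.+1%:Z).
      by rewrite !partial_hE big_ord_recr.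
    have km : k - 1 - M.+1%:Z = k - M.+2%:Z by rewrite -[M.+2]addn1 PoszD opprD addrA addrAC.
    rewrite !split_h km h0; move: IHM; move: (partial_h 0 M.+1 x k) (partial_h 0 M.+1 x (k - 1)) => a b e.
    have -> : x k = (2^-1 ^+ M.+1)%:C%C * x (k - M.+1%:Z) + (a - half * b) by rewrite -e; ring.
    by rewrite [2^-1 ^+ M.+2]exprS rmorphM; ring.
  rewrite nrZ nr_iter_shift normc_real ger0_norm ?exprn_ge0 ?invr_ge0//.
  rewrite ler_wpM2r ?nr_ge0//.
  apply: (@le_trans _ _ (2^-1 ^+ M)).
    by rewrite exprS ler_piMl ?exprn_ge0 ?invr_ge0 ?invf_le1 ?ler1n.
  by rewrite lerXn2r ?nnegrE ?invr_ge0 ?divr_ge0//; lra.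
exists (3 * c + (8 ^+ j + 8 ^+ j.+1)) => [|x M].
  by rewrite !addr_ge0 ?mulr_ge0 ?exprn_ge0.
have -> : iter j.+1 blaschke x - comp_half (partial_h j.+1 M.+1 x) =
    blaschke (iter j blaschke x - comp_half (partial_h j M.+1 x)) +
    (h j M + h j.+1 M / 2)%:C%C *: iter M.+1 (@shift R p p1) x.
  rewrite -partial_h_step [blaschke (_ - _)]linearB blaschke_comp_half /=.
  by apply: ell_ext => k; rewrite !ellE; ring.
apply: (le_trans (nrD _ _)); rewrite nrZ nr_iter_shift normc_real.
have H1 : `|h j M + h j.+1 M / 2| <= (8 ^+ j + 8 ^+ j.+1) * (2 / 3) ^+ M.
  apply: (le_trans (ler_normD _ _)); rewrite mulrDl lerD ?h_decay//.
  rewrite normrM (ger0_norm (x := 2^-1)) ?invr_ge0//.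
  by apply: le_trans (h_decay _ _ _); rewrite ler_piMr ?invf_le1 ?ler1n.
rewrite (_ : (3 * c + (8 ^+ j + 8 ^+ j.+1)) * (2 / 3) ^+ M * nr x =
  3 * (c * (2 / 3) ^+ M * nr x) + (8 ^+ j + 8 ^+ j.+1) * (2 / 3) ^+ M * nr x); last by ring.
apply: lerD; last by rewrite ler_wpM2r ?nr_ge0.
by apply: (le_trans (nr_blaschke _)); rewrite ler_wpM2l.
Qed.

Lemma comp_half_sum n (F : nat -> X) : comp_half (\sum_(i < n) F i) = \sum_(i < n) comp_half (F i).
Proof. by rewrite /comp_half linear_sum scaler_sumr sumrB. Qed.

Lemma comp_halfZ a x : comp_half (a *: x) = a *: comp_half x.
Proof. by rewrite /comp_half; apply: ell_ext => k; rewrite !(ellE, shiftE); ring. Qed.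

(** The Wiener algebra bound: the shift is isometric on every l^p, so the l^1 norm of the
    coefficients dominates the operator norm, and 3/2 is the norm bound of [comp_half]. *)
Lemma blaschke_comb_bound (g : nat -> R[i]) n (B : R) x :
  (forall M, \sum_(k < M) normc (\sum_(j < n) g j * (h j k)%:C%C) <= B) ->
  nr (\sum_(j < n) g j *: iter j blaschke x) <= 3 / 2 * B * nr x.
Proof.
move=> gB.
have [c c0 Hc] : exists2 c : R, 0 <= c & forall M,
    nr (\sum_(j < n) g j *: (iter j blaschke x - comp_half (partial_h j M.+1 x)))
      <= c * (2 / 3) ^+ M.
  elim: n {gB} => [|n [c c0 IH]]; first by exists 0 => // M; rewrite big_ord0 nr0 mul0r.
  have [d d0 Hd] := blaschke_approx n.
  exists (c + normc (g n) * d * nr x).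
    by rewrite addr_ge0// !mulr_ge0 ?normc_ge0 ?nr_ge0.
  move=> M; rewrite big_ord_recr /=; apply: (le_trans (nrD _ _)); rewrite mulrDl lerD//.
  by rewrite nrZ -!mulrA ler_wpM2l ?normc_ge0// [nr x * _]mulrC mulrA.
apply: (@le_of_geometric _ _ _ c) => M.
have -> : \sum_(j < n) g j *: iter j blaschke x =
    \sum_(j < n) g j *: (iter j blaschke x - comp_half (partial_h j M.+1 x)) +
    comp_half (\sum_(i < M.+1) (\sum_(j < n) g j * (h j i)%:C%C) *: iter i (@shift R p p1) x).
  have -> : \sum_(i < M.+1) (\sum_(j < n) g j * (h j i)%:C%C) *: iter i (@shift R p p1) x
      = \sum_(j < n) g j *: partial_h j M.+1 x.
    under eq_bigr do rewrite scaler_suml.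
    rewrite exchange_big; apply: eq_bigr => j _ /=.
    by rewrite scaler_sumr; apply: eq_bigr => i _; rewrite scalerA.
  rewrite (comp_half_sum n (fun j => g j *: partial_h j M.+1 x)) -big_split /=.
  by apply: eq_bigr => j _; rewrite comp_halfZ -scalerDr subrK.
apply: (le_trans (nrD _ _)); rewrite addrC lerD ?Hc//.
apply: (le_trans (nr_comp_half_le _)); rewrite -[leRHS]mulrA ler_wpM2l ?divr_ge0//.
apply: (le_trans (nr_sum M.+1 (fun i => (\sum_(j < n) g j * (h j i)%:C%C) *: iter i (@shift R p p1) x))).
under eq_bigr do rewrite nrZ nr_iter_shift.
by rewrite -mulr_suml ler_wpM2r ?nr_ge0.
Qed.

Definition half_rot w x : X := half *: (x + w *: blaschke x).

Lemma half_rotD w x y : half_rot w (x + y) = half_rot w x + half_rot w y.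
Proof. by rewrite /half_rot [blaschke _]linearD; apply: ell_ext => k; rewrite !ellE; ring. Qed.

Lemma half_rotZ w a x : half_rot w (a *: x) = a *: half_rot w x.
Proof. by rewrite /half_rot [blaschke _]linearZ /=; apply: ell_ext => k; rewrite !ellE; ring. Qed.

Lemma iter_half_rotD w n x y : iter n (half_rot w) (x + y) = iter n (half_rot w) x + iter n (half_rot w) y.
Proof. by elim: n => [//|n IH]; rewrite !iterS IH half_rotD. Qed.

Lemma iter_half_rotZ w n a x : iter n (half_rot w) (a *: x) = a *: iter n (half_rot w) x.
Proof. by elim: n => [//|n IH]; rewrite !iterS IH half_rotZ. Qed.

Lemma iter_half_rot w n x : iter n (half_rot w) x =
  half ^+ n *: \sum_(j < n.+1) ('C(n, j)%:R * w ^+ j) *: iter j blaschke x.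
Proof.
elim: n => [|n IH]; first by rewrite big_ord1 bin0 !expr0 mulr1 !scale1r.
rewrite iterS IH /half_rot [half ^+ n.+1]exprS -scalerA; congr (_ *: _).
rewrite linearZ /= scalerA mulrC -scalerA -scalerDr; congr (_ *: _).
rewrite linear_sum scaler_sumr [RHS]big_ord_recl /= bin0 expr0 mulr1 scale1r.
have -> : \sum_(i < n.+1) ('C(n.+1, bump 0 i)%:R * w ^+ bump 0 i) *: blaschke (iter i blaschke x) =
  \sum_(i < n.+1) ('C(n, i.+1)%:R * w ^+ i.+1) *: iter i.+1 blaschke x +
  \sum_(i < n.+1) ('C(n, i)%:R * w ^+ i.+1) *: iter i.+1 blaschke x.
  rewrite -big_split /=; apply: eq_bigr => i _.
  by rewrite /bump /= binS natrD mulrDl scalerDl.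
rewrite addrA; congr (_ + _).
  rewrite big_ord_recl /= bin0 expr0 mulr1 scale1r; congr (_ + _).
  by rewrite [RHS]big_ord_recr /= bin_small// mul0r scale0r addr0.
by apply: eq_bigr => i _; rewrite linearZ /= scalerA mulrCA -exprS.
Qed.

(** For even exponents the binomial weights are [bpmf], and 120 = (3/2) 80. An odd exponent costs
    one more factor W, of norm at most (1 + 3)/2 = 2. *)
Lemma half_rot_bound w n x : normc w = 1 -> nr (iter n (half_rot w) x) <= 240 * nr x.
Proof.
move=> w1.
have even m : nr (iter m.*2 (half_rot w) x) <= 120 * nr x.
  rewrite iter_half_rot scaler_sumr.
  have -> : 120 = 3 / 2 * 80 :> R by field.
  have e (j : nat) : half ^+ m.*2 *: (('C(m.*2, j)%:R * w ^+ j) *: iter j blaschke x) =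
      ((bpmf R m j)%:C%C * w ^+ j) *: iter j blaschke x.
    rewrite scalerA mulrA; congr (_ * _ *: _).
    rewrite /bpmf rmorphM rmorph_nat mulrC; congr (_ * _).
    by rewrite -rmorphXn -mul2n exprM -exprVn; congr (_ ^+ _)%:C%C; field.
  under eq_bigr do rewrite e.
  by apply: (@blaschke_comb_bound (fun j => (bpmf R m j)%:C%C * w ^+ j)) => M; exact: packet_l1_complex.
have x0 := nr_ge0 x.
rewrite -[n]odd_double_half; case: (odd n) => /=; last first.
  rewrite add0n; have := even n./2; lra.
rewrite -?iterS /= /half_rot nr_half; have := even n./2; set y := iter _ _ _ => Hy.
have := nrD y (w *: blaschke y); rewrite nrZ w1 mul1r; have := nr_blaschke y; lra.
Qed.

End blaschke.

(** * The strong Kreiss condition *)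

Section kreiss.
Variables (R : realType) (p : \bar R) (p1 : (1 <= p)%E).
Local Notation X := (ell R p1).
Local Notation half := ((2^-1 : R)%:C%C).
Local Notation V := (blaschke p1).
Implicit Types (x y : X) (k : int) (l : R[i]).

Lemma normE x : `|x| = (nr x)%:C%C. Proof. by rewrite ell_normE. Qed.

Lemma opnorm_le (T : X -> X) (B : R) : 0 <= B ->
  (forall x, nr (T x) <= B * nr x) -> (opnorm T <= B%:E)%E.
Proof.
move=> B0 TB; apply: ge_ereal_sup => _ [x x1 <-]; rewrite lee_fin normE /=.
apply: (le_trans (TB x)); rewrite ler_piMr//.
by move: x1; rewrite /= normE (_ : 1 = 1%:C%C)// lecR.
Qed.

Lemma opnorm_ge (T : X -> X) x : 0 < nr x ->
  (forall a x, T (a *: x) = a *: T x) -> ((nr (T x) / nr x)%:E <= opnorm T)%E.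
Proof.
move=> x0 TZ; apply: ereal_sup_ubound; exists ((nr x)^-1%:C%C *: x).
  rewrite /= normE nrZ normc_real ger0_norm ?invr_ge0 ?nr_ge0//.
  by rewrite mulVf ?gt_eqF.
rewrite TZ normE nrZ normc_real ger0_norm ?invr_ge0 ?nr_ge0//=.
by rewrite mulrC.
Qed.

Lemma bounded_operatorP (T : {linear X -> X}) (B : R) :
  (forall x, nr (T x) <= B * nr x) -> bounded_operator T.
Proof. by move=> H; exists B%:C%C => x; rewrite !normE -rmorphM lecR. Qed.

Lemma blaschke_resolvent_eq l x k :
  (l *: x - V x) k - half * (l *: x - V x) (k - 1) =
  (l + half) * x k - (1 + half * l) * x (k - 1).
Proof. by rewrite !ellE (blaschkeE x k); ring. Qed.

(** l - b(s) = ((l + 1/2) - (1 + l/2) s)/(1 - s/2), so the resolvent is again a Moebius function of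
    the shift. Its pole is outside the closed disk because |l + 1/2|^2 - |1 + l/2|^2 = (3/4)(|l|^2 -
    1). *)
Lemma blaschke_resolvent_ex l : 1 < normc l -> exists T, is_resolvent V l T.
Proof.
move=> l1.
have den : normc (1 + half * l) < normc (l + half).
  rewrite -(@ltr_pXn2r _ 2) ?nnegrE ?normc_ge0// !normc_sq.
  have : 1 < normc l ^+ 2 by rewrite expr_gt1 ?normc_ge0.
  rewrite normc_sq; case: l {l1} => a b /=.
  by rewrite !expr2 => ?; lra.
have lh0 : l + half != 0.
  by apply/eqP => e; move: den; rewrite e normc0; rewrite ltNge normc_ge0.
have lh1 : 0 < normc (l + half) by rewrite (le_lt_trans (normc_ge0 _) den).
set c := (l + half)^-1.
pose q := (1 + half * l) * c.
have q1 : normc q < 1.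
  by rewrite /q normcM normcV ltr_pdivrMr// mul1r.
have qE : q * (l + half) = 1 + half * l by rewrite /q mulfVK.
have cE : c * (l + half) = 1 by rewrite mulVf.
pose T : {linear X -> X} := mob c ((q - half) * c) q1.
have TE x : T x - q *: shift (T x) = c *: x - (half * c) *: shift x.
  by rewrite mobE (_ : _ - q * c = - (half * c)) ?scaleNr//; ring.
have TEk x k : T x k - q * T x (k - 1) = c * x k - half * c * x (k - 1).
  by have := congr1 (fun z : X => z k) (TE x); rewrite !(ellN, ell_valD, ell_valZ, shiftE).
exists T; split.
- apply: (@bounded_operatorP T (normc c * (3 / 2) / (1 - normc q))) => x.
  have q2 : 0 < 1 - normc q by rewrite subr_gt0.
  rewrite mulrAC ler_pdivlMr//.
  have := nrD (c *: x - (half * c) *: shift x) (q *: shift (T x)).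
  rewrite -{1}TE subrK; have := nrB (c *: x) ((half * c) *: shift x).
  rewrite !nrZ !nr_shift normcM normc_real (ger0_norm (x := 2^-1)) ?invr_ge0//.
  move: (nr (T x)) (nr _) => a b; lra.
- move=> x; apply: (shift_inj q1); apply: ell_ext => k.
  rewrite TE; have := blaschke_resolvent_eq l x k; move: (l *: x - V x) => y e.
  rewrite !(ellN, ell_valD, ell_valZ, shiftE).
  transitivity (c * (y k - half * y (k - 1))); first by ring.
  by rewrite e -qE; transitivity (c * (l + half) * (x k - q * x (k - 1))); [ring|rewrite cE; ring].
- move=> x; apply: (shift_inj (normc_half R)); apply: ell_ext => k.
  have := blaschke_resolvent_eq l (T x) k; move: (l *: T x - V (T x)) => y e.
  rewrite [LHS]ell_valD ellN ell_valZ shiftE e -qE.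
  transitivity ((l + half) * (T x k - q * T x (k - 1))); first by ring.
  rewrite TEk !(ellE, shiftE); transitivity (c * (l + half) * (x k - half * x (k - 1))); first by ring.
  by rewrite cE mul1r.
Qed.

Definition renorm w x : R := sup [set nr (iter n (half_rot w) x) | n in setT].

Lemma renorm_has_sup w x : normc w = 1 ->
  has_sup [set nr (iter n (half_rot w) x) | n in setT].
Proof.
move=> w1; split; first by exists (nr x); exists 0%N.
by exists (240 * nr x) => _ [n _ <-]; exact: half_rot_bound.
Qed.

Lemma le_renorm w n x : normc w = 1 -> nr (iter n (half_rot w) x) <= renorm w x.
Proof.
by move=> w1; apply: ub_le_sup; [case: (renorm_has_sup x w1)|exists n].
Qed.

Lemma renorm_le w x (B : R) : normc w = 1 ->
  (forall n, nr (iter n (half_rot w) x) <= B) -> renorm w x <= B.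
Proof.
move=> w1 H; apply: ge_sup; first by case: (renorm_has_sup x w1).
by move=> _ [n _ <-].
Qed.

(* Powers of [W = (1 + w V) / 2] are bounded, and [l - V] is, up to a
   unimodular factor, [|l| + 1 - 2 W]: hence [l - V] expands the equivalent norm
   [sup_n |W ^ n x|] by at least [|l| - 1]. *)
Lemma blaschke_resolvent_bound l (T : X -> X) (k : nat) x : 1 < normc l ->
  (forall x, l *: T x - V (T x) = x) ->
  nr (iter k T x) <= 240 / (normc l - 1) ^+ k * nr x.
Proof.
move=> l1 TE; have l0 : l != 0.
  by apply/eqP => e; move: l1; rewrite e normc0 ltr10.
have nl0 : normc l != 0 by rewrite gt_eqF// (lt_trans ltr01).
pose w := (normc l)%:C%C / l.
have w1 : normc w = 1.
  by rewrite /w normcM normcV normc_real ger0_norm ?normc_ge0// mulfV.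
have wl : w * l = (normc l)%:C%C by rewrite /w mulfVK.
have d0 : 0 < normc l - 1 by rewrite subr_gt0.
have step y : renorm w (T y) <= renorm w y / (normc l - 1).
  have e : (normc l + 1)%:C%C *: T y = w *: y + (2 : R)%:C%C *: half_rot w (T y).
    rewrite -{2}(TE y) /half_rot; apply: ell_ext => i; rewrite !ellE rmorphD /= -wl.
    have -> : (2 : R)%:C%C * (half * (T y i + w * V (T y) i)) = T y i + w * V (T y) i.
      by rewrite mulrA -rmorphM mulfV// mul1r.
    by ring.
  have c0 : 0 < normc l + 1 by lra.
  have : renorm w (T y) <= (renorm w y + 2 * renorm w (T y)) / (normc l + 1).
    apply: renorm_le => // n; rewrite ler_pdivlMr// mulrC.
    have -> : (normc l + 1) * nr (iter n (half_rot w) (T y)) =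
        nr (iter n (half_rot w) ((normc l + 1)%:C%C *: T y)).
      by rewrite iter_half_rotZ nrZ normc_real gtr0_norm.
    rewrite e iter_half_rotD (iter_half_rotZ w n w) (iter_half_rotZ w n (2 : R)%:C%C).
    apply: (le_trans (nrD _ _)).
    rewrite !nrZ w1 mul1r normc_real gtr0_norm// lerD ?le_renorm// ler_wpM2l//.
    by rewrite -iterSr le_renorm.
  rewrite !ler_pdivlMr//; lra.
have : renorm w (iter k T x) <= renorm w x / (normc l - 1) ^+ k.
  elim: k => [|k IH]; first by rewrite expr0 divr1.
  rewrite iterS (le_trans (step _))// exprSr invfM mulrA ler_wpM2r// invr_ge0 ltW//.
move=> H; apply: (le_trans (le_renorm 0 _ w1)); apply: (le_trans H).
rewrite mulrAC ler_wpM2r ?invr_ge0 ?exprn_ge0 ?(ltW d0)//.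
by apply: renorm_le => // n; exact: half_rot_bound.
Qed.

Lemma blaschke_strongly_kreiss : strongly_kreiss_bounded V.
Proof.
split.
  move=> l nres /=; rewrite -normc_normr (_ : 1 = 1%:C%C)// lecR leNgt.
  by apply/negP => /blaschke_resolvent_ex.
exists 240 => [|l T k]; first exact: ltr0Sn.
rewrite -normc_normr (_ : 1 = 1%:C%C)// ltcR => l1 [_ _ TE] _.
apply: opnorm_le => [|x]; last exact: blaschke_resolvent_bound.
by apply: divr_ge0; [exact: ler0n|rewrite exprn_ge0// subr_ge0 ltW].
Qed.

Lemma blaschke_bounded : bounded_operator V.
Proof. by apply: bounded_operatorP => x; exact: nr_blaschke. Qed.

End kreiss.

Lemma blaschke_restriction (R : realType) (p : \bar R) (p1 : (1 <= p)%E) :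
  is_restriction (@blaschke R +oo (leey 1)) (blaschke p1).
Proof.
move=> x; apply: (shift_inj (normc_half R)); apply: ell_ext => k.
rewrite !(ellE, shiftE) (blaschkeE (ell_incl x)).
rewrite -[ell_incl (blaschke p1 x) k]/(blaschke p1 x k) blaschkeE.
rewrite -[ell_incl (blaschke p1 x) _]/(blaschke p1 x _).
rewrite -![ell_incl x _]/(x _).
by ring.
Qed.

(** * Growth of the powers: upper bound *)

Lemma fir_window_complex (R : realType) N (x : nat -> R[i]) :
  \sum_(i < 6 * N) normc (\sum_(k < 6 * N) (blaschke_coef R N k)%:C%C * x (6 * N + i - k)%N) ^+ 2 <=
  26 * \sum_(j < 6 * N + 6 * N) normc (x j) ^+ 2.
Proof.
set L := (6 * N)%N.
have re := fir_window N (fun j => complex.Re (x j)).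
have im := fir_window N (fun j => complex.Im (x j)).
rewrite -/L in re im.
under eq_bigr do rewrite normc_sq Re_sum Im_sum.
under [X in _ <= 26 * X]eq_bigr do rewrite normc_sq.
rewrite !big_split /= mulrDr.
apply: lerD.
  apply: le_trans re; rewrite le_eqVlt; apply/orP; left; apply/eqP.
  by apply: eq_bigr => i _; congr (_ ^+ 2); apply: eq_bigr => k _; rewrite ReZ.
apply: le_trans im; rewrite le_eqVlt; apply/orP; left; apply/eqP.
by apply: eq_bigr => i _; congr (_ ^+ 2); apply: eq_bigr => k _; rewrite ImZ.
Qed.

Lemma esum_nr (R : realType) (r : R) (p1 : (1 <= r%:E)%E) (x : ell R p1) :
  (\esum_(k in setT) (normc (x k) `^ r)%:E = (nr x `^ r)%:E)%E.
Proof. by rewrite -ellnorm_powR ?nrE// (lt_le_trans ltr01). Qed.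

(* Sum over [a]: every index is counted [m] times on the left, [n] on the right. *)
Lemma window_le (R : realType) (r : R) (p1 : (1 <= r%:E)%E) (x y : ell R p1) (c m n : nat) :
  (forall a : int, \sum_(i < m) normc (y (a + (c + i)%N%:Z)) `^ r <=
     \sum_(j < n) normc (x (a + j%:Z)) `^ r) ->
  m%:R * nr y `^ r <= n%:R * nr x `^ r.
Proof.
move=> H.
have E (z : ell R p1) (d l : nat) :
    (\esum_(a in setT) \sum_(i < l) (normc (z (a + (d + i)%N%:Z)%R) `^ r)%:E)%E =
    (l%:R * nr z `^ r)%:E.
  rewrite esum_sum => [|a i _ _]; last by rewrite lee_fin powR_ge0.
  under eq_bigr do rewrite (esum_shift (fun k => (normc (z k) `^ r)%:E)) esum_nr.
  by rewrite sumEFin sumr_const card_ord mulr_natl.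
rewrite -lee_fin -(E y c) -(E x 0%N); apply: le_esum => a _.
by rewrite !sumEFin lee_fin.
Qed.

Section upper_bound.
Variables (R : realType) (p : \bar R) (p1 : (1 <= p)%E).
Local Notation X := (ell R p1).
Local Notation V := (blaschke p1).
Implicit Types (x y : X) (N : nat).

Lemma fir_local N x (a : int) :
  \sum_(i < 6 * N) normc (partial_h N (6 * N) x (a + (6 * N + i)%N%:Z)) ^+ 2 <=
  26 * \sum_(j < 6 * N + 6 * N) normc (x (a + j%:Z)) ^+ 2.
Proof.
apply: le_trans (fir_window_complex N (fun j => x (a + j%:Z))).
rewrite le_eqVlt; apply/orP; left; apply/eqP; apply: eq_bigr => i _; congr (normc _ ^+ 2).
rewrite partial_hE; apply: eq_bigr => k _; congr (_ * ell_val x _).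
have kN := ltn_ord k; rewrite -addrA; congr (_ + _).
by rewrite -subzn// (leq_trans (ltnW kN))// leq_addr.
Qed.

End upper_bound.

Lemma powR_ge1 (R : realType) (a e : R) : 1 <= a -> 0 <= e -> 1 <= a `^ e.
Proof. by move=> a1 e0; rewrite -[leLHS](powRr0 a) ler_powR. Qed.

Lemma powR_le_self (R : realType) (a e : R) : 1 <= a -> e <= 1 -> a `^ e <= a.
Proof. by move=> a1 e1; rewrite -[leRHS]powRr1 ?ler_powR// (le_trans ler01). Qed.

Lemma natr_double6 (R : realType) N : (6 * N + 6 * N)%:R = 12 * N%:R :> R.
Proof. by rewrite -mulnDl natrM. Qed.

Lemma le_powR_root (R : realType) (r K u v : R) : 0 < r -> 0 <= K -> 0 <= u -> 0 <= v ->
  u `^ r <= K * v `^ r -> u <= K `^ r^-1 * v.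
Proof.
move=> r0 K0 u0 v0 H.
have rK (z : R) : 0 <= z -> (z `^ r) `^ r^-1 = z.
  by move=> z0; rewrite -powRrM mulfV ?gt_eqF// powRr1.
rewrite -(rK u)// -(rK v)// -powRM ?powR_ge0//.
apply: ge0_ler_powR => //; rewrite ?nnegrE ?mulr_ge0 ?powR_ge0//.
by rewrite invr_ge0 ltW.
Qed.

Lemma fir_bound_fin (R : realType) (r : R) (p1 : (1 <= r%:E)%E) N (x : ell R p1) : (1 <= N)%N ->
  nr (partial_h N (6 * N) x) <= 26 * 24 * N%:R `^ `|2^-1 - r^-1| * nr x.
Proof.
move=> N1; have r1 : 1 <= r by [].
have r0 : 0 < r by rewrite (lt_le_trans ltr01).
have n0 : 0 <= N%:R :> R by [].
set L := (6 * N)%N; have L0 : (0 < L)%N by rewrite /L; lia.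
have L2 : 0 < L%:R :> R by rewrite ltr0n.
(* [Kc] is the loss of [sum_powR_compare]; scaling x by its r-th root [kap] gives the inequality
   without constant that [window_le] asks for. *)
pose Kc : R := 26 `^ (r / 2) * (L + L)%:R `^ `|1 - r / 2|.
have Kc0 : 0 <= Kc by rewrite mulr_ge0 ?powR_ge0.
pose kap := Kc `^ r^-1.
have kap0 : 0 <= kap by exact: powR_ge0.
have kapr : kap `^ r = Kc by rewrite -powRrM mulVf ?gt_eqF// powRr1.
have sq z : 0 <= z -> (z ^+ 2) `^ (r / 2) = z `^ r.
  by move=> z0; rewrite -powR_mulrn// -powRrM mulrC divfK.
have win (a : int) : \sum_(i < L) normc (partial_h N L x (a + (L + i)%N%:Z)) `^ r <=
   \sum_(j < L + L) normc ((kap%:C%C *: x) (a + j%:Z)) `^ r.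
  under [leRHS]eq_bigr do rewrite ell_valZ normcM powRM ?normc_ge0// normc_real ger0_norm// kapr.
  rewrite -mulr_sumr.
  have := @sum_powR_compare R (fun i => normc (partial_h N L x (a + (L + i)%N%:Z)) ^+ 2)
    (fun j => normc (x (a + j%:Z)) ^+ 2) L (L + L) 26 (r / 2)
    (divr_gt0 r0 (ltr0Sn _ 1)) _ L0 (leq_addr _ _) (fun=> sqr_ge0 _) (fun=> sqr_ge0 _)
    (fir_local N x a).
  have e1 (z : nat -> R[i]) n : \sum_(i < n) (normc (z i) ^+ 2) `^ (r / 2) =
      \sum_(i < n) normc (z i) `^ r.
    by apply: eq_bigr => i _; rewrite sq ?normc_ge0.
  rewrite (e1 (fun i => partial_h N L x (a + (L + i)%N%:Z))) (e1 (fun j => x (a + j%:Z))).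
  by apply; rewrite ler1n.
have := window_le win; rewrite nrZ normc_real (ger0_norm kap0) powRM ?nr_ge0// kapr natrD.
rewrite mulrDl -mulrDr (ler_pM2l L2) => H.
have : nr (partial_h N L x) <= (2 * Kc) `^ r^-1 * nr x.
  apply: (le_powR_root r0 (mulr_ge0 _ Kc0)); rewrite ?nr_ge0//.
  by rewrite -mulrA mulr_natl mulr2n.
move=> /le_trans; apply; rewrite ler_wpM2r ?nr_ge0//.
have ri : r^-1 <= 1 by rewrite invf_le1.
have ri0 : 0 < r^-1 by rewrite invr_gt0.
rewrite /Kc !powRM ?mulr_ge0 ?powR_ge0// -!powRrM.
have -> : r / 2 * r^-1 = 2^-1 by rewrite mulrAC mulfV ?gt_eqF// mul1r.
have -> : `|1 - r / 2| * r^-1 = `|2^-1 - r^-1|.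
  rewrite -{1}[r^-1]gtr0_norm// -normrM distrC; congr (`|_|).
  by rewrite mulrBl mulrAC mulfV ?gt_eqF// !mul1r.
set e := `|2^-1 - r^-1|.
have e1 : e <= 1 by rewrite /e ler_norml; lra.
have a1 : 2 `^ r^-1 <= 2 :> R by apply: powR_le_self => //; rewrite ler1n.
have a2 : 26 `^ 2^-1 <= 26 :> R by apply: powR_le_self; rewrite ?ler1n// invf_le1 ?ler1n.
have a3 : (L + L)%:R `^ e <= 12 * N%:R `^ e :> R.
  have -> : (L + L)%:R = 12 * N%:R :> R by exact: natr_double6.
  by rewrite powRM// ler_wpM2r ?powR_ge0// powR_le_self// ler1n.
have -> : 26 * 24 = 2 * (26 * 12) :> R by ring.
rewrite -!mulrA !ler_pM ?mulr_ge0 ?powR_ge0//.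
Qed.

Lemma fir_bound_infty (R : realType) (p1 : (1 <= +oo :> \bar R)%E) N (x : ell R p1) : (1 <= N)%N ->
  nr (partial_h N (6 * N) x) <= 26 * 24 * N%:R `^ `|2^-1| * nr x.
Proof.
move=> N1; rewrite -lee_fin -nrE ellnorm_infty; apply: ge_ereal_sup => _ [k _ <-].
rewrite lee_fin; set L := (6 * N)%N.
have := fir_local N x (k - L%:Z); rewrite -/L => H.
have L0 : (0 < L)%N by rewrite /L; lia.
have y0 : 0 <= 26 * 24 * N%:R `^ `|2^-1| * nr x by rewrite mulr_ge0 ?nr_ge0// mulr_ge0 ?powR_ge0.
rewrite -(@ler_pXn2r _ 2) ?nnegrE ?normc_ge0//.
have H1 : normc (partial_h N L x k) ^+ 2 <= 26 * ((L + L)%:R * nr x ^+ 2).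
  apply: le_trans (le_trans H _).
    rewrite (bigD1 (Ordinal L0)) //= addn0 subrK lerDl sumr_ge0// => *; exact: sqr_ge0.
  rewrite ler_wpM2l// mulr_natl -[in leRHS](card_ord (L + L)) -sumr_const.
  by apply: ler_sum => j _; rewrite lerXn2r ?nnegrE ?normc_ge0 ?nr_ge0// normc_le_nr.
apply: (le_trans H1); rewrite !exprMn ger0_norm ?invr_ge0// -[(_ `^ _) ^+ 2]powR_mulrn ?powR_ge0//.
rewrite -powRrM mulVf// powRr1// mulrA ler_wpM2r ?sqr_ge0//.
have -> : (L + L)%:R = 12 * N%:R :> R by exact: natr_double6.
rewrite mulrA ler_wpM2r//.
by rewrite !expr2; lra.
Qed.

(** The coefficients beyond 6 N add at most 3, by [h_tail], and (3/2)(26 24 + 3) < 1000. *)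
Lemma blaschke_iter_upper (R : realType) (p : \bar R) (p1 : (1 <= p)%E) N (x : ell R p1) :
  (1 <= N)%N ->
  nr (iter N (blaschke p1) x) <= 1000 * N%:R `^ `|2^-1 - fine p^-1| * nr x.
Proof.
move=> N1.
have fir : nr (partial_h N (6 * N) x) <= 26 * 24 * N%:R `^ `|2^-1 - fine p^-1| * nr x.
  case: p p1 x => [r r1 x|r1 x|//]; last by rewrite invey subr0; exact: fir_bound_infty.
  have r0 : r != 0 by rewrite gt_eqF// (lt_le_trans ltr01).
  by rewrite inver (negbTE r0); exact: fir_bound_fin.
have [c c0 Hc] := @blaschke_approx R p p1 N.
set e := `| _ |; have e1 : 1 <= N%:R `^ e by apply: powR_ge1; rewrite ?ler1n ?normr_ge0.
apply: (@le_of_geometric _ _ _ (c * nr x)) => M.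
set M' := (6 * N + M)%N.
have -> : iter N (blaschke p1) x =
   (iter N (blaschke p1) x - comp_half (partial_h N M'.+1 x)) + comp_half (partial_h N M'.+1 x).
  by rewrite subrK.
apply: (le_trans (nrD _ _)); rewrite addrC lerD//; last first.
  apply: (le_trans (Hc x M')); rewrite mulrAC ler_wpM2l ?mulr_ge0 ?nr_ge0//.
  by rewrite ler_wiXn2l ?divr_ge0// /M' ?leq_addl//; lra.
apply: (le_trans (nr_comp_half_le _)).
have tail : nr (partial_h N M'.+1 x - partial_h N (6 * N) x) <= 3 * nr x.
  have -> : partial_h N M'.+1 x - partial_h N (6 * N) x =
      \sum_(i < M.+1) (blaschke_coef R N (6 * N + i))%:C%C *: iter (6 * N + i) (@shift R p p1) x.
    rewrite /partial_h /M' -addnS big_split_ord /= [X in X - _]addrC addrK.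
    by apply: eq_bigr.
  apply: (le_trans (nr_sum _ (fun i => (blaschke_coef R N (6 * N + i))%:C%C *: iter (6 * N + i) (@shift R p p1) x))).
  under eq_bigr do rewrite nrZ normc_real nr_iter_shift.
  rewrite -mulr_suml ler_wpM2r ?nr_ge0//.
  apply: le_trans (h_tail R N (6 * N + M.+1)).
  have -> : \sum_(6 * N <= k < 6 * N + M.+1) `|blaschke_coef R N k| = \sum_(i < M.+1) `|blaschke_coef R N (6 * N + i)|.
    rewrite -[X in \sum_(X <= _ < _) _]add0n big_addn addKn big_mkord.
    by apply: eq_bigr => i _; rewrite addnC.
  by [].
have := nrD (partial_h N M'.+1 x - partial_h N (6 * N) x) (partial_h N (6 * N) x); rewrite subrK.
move: fir tail; rewrite -/e; move: e1 (nr_ge0 x); move: (nr x) (nr _) (nr _) (nr _) (N%:R `^ e) => a b c' d q q1 a0.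
move=> u1 u2 u3; have := ler_wpM2r a0 q1; rewrite -!mulrA in u1 *; lra.
Qed.

(** * Growth of the powers: lower bound *)

Section spread_constant.
Variable R : realType.
Local Notation h := (blaschke_coef R).

(** The bound of [h_sup], with (1 + 408/N)^(3N) <= exp(3 408). *)
Definition spread : R := 1800 * expR (3 * 408).

Lemma spread_ge1 : 1 <= spread.
Proof.
have : 1 <= expR (3 * 408) :> R by rewrite -[leLHS]expR0 ler_expR -natrM ler0n.
rewrite /spread; move: (expR _) => e; lra.
Qed.

Lemma h_spread N k : (408 <= N)%N -> (2 * N <= 3 * k <= 8 * N)%N ->
  N%:R * h N k ^+ 2 <= spread.
Proof.
move=> N4 kN; apply: h_sup => //.
have N0 : 0 < N%:R :> R by rewrite ltr0n (leq_trans _ N4).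
apply: (@le_trans _ _ (expR (408 / N%:R) ^+ (3 * N))).
  have q0 : 0 <= 408 / N%:R :> R := divr_ge0 (ler0n _ _) (ltW N0).
  by rewrite lerXn2r ?nnegrE ?expR_ge0 ?expR_ge1Dx ?(addr_ge0 ler01 q0).
rewrite -expRM_natl ler_expR natrM le_eqVlt; apply/orP; left; apply/eqP.
by rewrite -mulrA; congr (_ * _); rewrite mulrCA mulfV ?gt_eqF// mulr1.
Qed.

End spread_constant.

Section finite_support.
Variables (R : realType) (p : \bar R) (p1 : (1 <= p)%E).
Local Notation X := (ell R p1).
Implicit Types (a : nat -> R[i]) (e : nat -> int).

Lemma delta_subproof (n : int) : restr [set n] (cst (1 : R[i])) \in ell_pred p.
Proof. by rewrite inE /=; apply: ellnorm_restr_cst. Qed.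

Definition delta (n : int) : X := Ell p1 (delta_subproof n).

Lemma deltaE n k : delta n k = (k == n)%:R.
Proof.
rewrite /delta /= /restr; case: ifPn => [/set_mem/= ->|]; first by rewrite eqxx.
by case: eqP => // ->; rewrite mem_set.
Qed.

Definition delta_comb a e n : X := \sum_(i < n) a i *: delta (e i).

Lemma delta_combE a e n k : delta_comb a e n k = \sum_(i < n) a i * (k == e i)%:R.
Proof.
rewrite /delta_comb (ell_sum n (fun i => a i *: delta (e i))); apply: eq_bigr => i _.
by rewrite ell_valZ deltaE.
Qed.

Lemma delta_comb_val a e n i : injective e -> delta_comb a e n (e i) = if (i < n)%N then a i else 0.
Proof.
move=> ei; rewrite delta_combE; case: ifPn => [iN|iN].
  rewrite (bigD1 (Ordinal iN)) //= eqxx mulr1 big1 ?addr0// => j /eqP jN.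
  case: eqP => [/ei ij|_]; last by rewrite mulr0.
  by case: jN; apply: val_inj.
rewrite big1// => j _; case: eqP => [/ei ij|_]; last by rewrite mulr0.
by move: iN; rewrite ij ltn_ord.
Qed.

Lemma delta_comb_val0 a e n k : (forall i, (i < n)%N -> k != e i) -> delta_comb a e n k = 0.
Proof. by move=> H; rewrite delta_combE big1// => i _; rewrite (negbTE (H i _)) ?mulr0. Qed.

Lemma delta_comb_normc_le a e n k (B : R) : injective e -> 0 <= B ->
  (forall i, (i < n)%N -> normc (a i) <= B) -> normc (delta_comb a e n k) <= B.
Proof.
move=> ei B0 aB; have [[i iN ->]|no] := pselect (exists2 i, (i < n)%N & k = e i).
  by rewrite delta_comb_val// iN aB.
rewrite delta_comb_val0 ?normc0// => i iN; apply/eqP => ke.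
by apply: no; exists i.
Qed.

End finite_support.

Lemma nr_delta_comb_powR (R : realType) (r : R) (p1 : (1 <= r%:E)%E) a e n : injective e ->
  nr (delta_comb p1 a e n) `^ r = \sum_(i < n) normc (a i) `^ r.
Proof.
move=> ei; have r0 : r != 0 by rewrite gt_eqF// (lt_le_trans ltr01).
elim: n => [|n IH]; first by rewrite /delta_comb !big_ord0 nr0 powR0.
rewrite big_ord_recr /= -IH; apply: EFin_inj; rewrite EFinD -!esum_nr.
have -> : ((normc (a n) `^ r)%:E = \esum_(k in setT) if k \in [set e n] then (normc (a n) `^ r)%:E else 0)%E.
  by rewrite -esum_mkcond esum_set1// lee_fin powR_ge0.
rewrite -esumD => [|k _|k _]; [|by rewrite lee_fin powR_ge0|by case: ifP; rewrite // lee_fin powR_ge0].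
apply: eq_esum => k _; have -> : delta_comb p1 a e n.+1 k = delta_comb p1 a e n k + a n * (k == e n)%:R.
  by rewrite !delta_combE big_ord_recr.
case: ifPn => [/set_mem/= ->|kn].
  by rewrite delta_comb_val// ltnn normc0 powR0// add0r eqxx mulr1 add0e.
have /negbTE -> : k != e n by apply/eqP => kn'; move/negP: kn; apply; exact/mem_set.
by rewrite mulr0 addr0 adde0.
Qed.

Section lower_bound.
Variables (R : realType) (p : \bar R) (p1 : (1 <= p)%E).
Local Notation X := (ell R p1).
Local Notation V := (blaschke p1).
Local Notation h := (blaschke_coef R).
Implicit Types (x y : X) (N : nat).

Lemma blaschke_iter_ge N x (B : R) :
  (forall M, (12 * N <= M)%N -> B <= nr (partial_h N M x)) -> B / 2 <= nr (iter N V x).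
Proof.
move=> H; have [c c0 Hc] := @blaschke_approx R p p1 N.
apply: (@le_of_geometric _ _ _ (c * nr x)) => M; set M' := (12 * N + M)%N.
have h1 := H M'.+1 (leq_trans (leq_addr _ _) (leqnSn _)).
have h2 := nr_comp_half_ge (partial_h N M'.+1 x).
have h3 := nrB (iter N V x) (iter N V x - comp_half (partial_h N M'.+1 x)).
have h4 : nr (iter N V x - comp_half (partial_h N M'.+1 x)) <= c * nr x * (2 / 3) ^+ M.
  apply: (le_trans (Hc x M')); rewrite mulrAC ler_wpM2l ?mulr_ge0 ?nr_ge0//.
  by rewrite ler_wiXn2l ?divr_ge0// /M' ?leq_addl//; lra.
rewrite opprB addrC subrK in h3; lra.
Qed.

Lemma partial_h_delta N M : partial_h N M (delta p1 0) = delta_comb p1 (fun i => (h N i)%:C%C) Posz M.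
Proof.
apply: ell_ext => k; rewrite partial_hE delta_combE; apply: eq_bigr => i _.
by rewrite deltaE subr_eq0.
Qed.

Definition window N i : bool := (2 * N <= 3 * i <= 8 * N)%N.

(** A matched filter: the window coefficients reversed in time, so that the output at 0 is their
    square sum, bounded below by [h_mass]. It serves for p >= 2, where a spread-out vector has small
    norm; for p < 2 the impulse [delta] is used, whose image is spread out. *)
Definition window_test N : X :=
  delta_comb p1 (fun i => if window N i then (h N i)%:C%C else 0) (fun i => - i%:Z) (12 * N).

Lemma window_test_val N i : window_test N (- i%:Z) =
  if (i < 12 * N)%N && window N i then (h N i)%:C%C else 0.
Proof.
rewrite /window_test delta_comb_val; last by move=> a b /oppr_inj [].
by case: ifP.
Qed.

Lemma partial_h_window_test N M : (20 <= N)%N -> (12 * N <= M)%N ->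
  1 / 20 <= nr (partial_h N M (window_test N)).
Proof.
move=> N20 NM; apply: le_trans (normc_le_nr _ 0).
have -> : partial_h N M (window_test N) 0 = (\sum_(i < 12 * N | window N i) h N i ^+ 2)%:C%C.
  rewrite partial_hE; under eq_bigr do rewrite sub0r window_test_val.
  rewrite -(subnKC NM) big_split_ord /= [X in _ + X]big1 ?addr0 => [|i _]; last first.
    by rewrite ltnNge leq_addr mulr0.
  rewrite rmorph_sum [RHS]big_mkcond /=; apply: eq_bigr => i _; rewrite ltn_ord /=.
  by case: ifP => _; rewrite ?mulr0// -rmorphM expr2.
by rewrite normc_real; apply: le_trans (ler_norm _); exact: h_mass.
Qed.

End lower_bound.

Section lower_exponent.
Variable R : realType.
Local Notation h := (blaschke_coef R).

Lemma h_window_abs N k : (408 <= N)%N -> window N k ->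
  `|h N k| <= (spread R / N%:R) `^ 2^-1.
Proof.
move=> N4 kN; have N0 : 0 < N%:R :> R by rewrite ltr0n (leq_trans _ N4).
rewrite -(@ler_pXn2r _ 2) ?nnegrE ?powR_ge0// -powR_mulrn ?powR_ge0// -[leRHS]powR_mulrn ?powR_ge0//.
rewrite -[leRHS]powRrM mulVf// powRr1; last first.
  by rewrite divr_ge0 ?(ltW N0)// (le_trans ler01) ?spread_ge1.
by rewrite powR_mulrn// real_normK ?num_real// ler_pdivlMr// mulrC h_spread.
Qed.

(** Interpolation between mass and maximum. Summed over the window, with B of order N^(-1/2), it
    bounds the l^r mass from below for r <= 2 and from above for r >= 2. *)
Lemma powR_split (b B r : R) : 0 <= b -> 0 < B -> b <= B -> 0 < r ->
  (r <= 2 -> b ^+ 2 <= b `^ r * B `^ (2 - r)) /\ (2 <= r -> b `^ r <= b ^+ 2 * B `^ (r - 2)).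
Proof.
move=> b0 B0 bB r0; split=> r2.
  have [->|bn] := eqVneq b 0; first by rewrite expr0n mulr_ge0 ?powR_ge0.
  have -> : b ^+ 2 = b `^ r * b `^ (2 - r).
    have e : r + (2 - r) = 2%:R by ring.
    by rewrite -powRD; [rewrite e powR_mulrn|rewrite bn implybT].
  by rewrite ler_wpM2l ?powR_ge0// ge0_ler_powR ?nnegrE ?subr_ge0// ltW.
have [->|bn] := eqVneq b 0; first by rewrite powR0 ?gt_eqF// mulr_ge0 ?powR_ge0 ?sqr_ge0.
have -> : b `^ r = b ^+ 2 * b `^ (r - 2).
  have e : 2%:R + (r - 2) = r by ring.
  by rewrite -powR_mulrn// -powRD; [rewrite e|rewrite bn implybT].
by rewrite ler_wpM2l ?sqr_ge0// ge0_ler_powR ?nnegrE ?subr_ge0// ltW.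
Qed.

Lemma root_spread_le N (e : R) : (408 <= N)%N -> 0 <= e -> e <= 1 / 2 ->
  (spread R / N%:R) `^ e <= spread R / N%:R `^ e.
Proof.
move=> N4 e0 e1; have N0 : 0 < N%:R :> R by rewrite ltr0n (leq_trans _ N4).
have s1 := spread_ge1 R; have s0 : 0 <= spread R := le_trans ler01 s1.
have Ne : N%:R^-1 `^ e = (N%:R `^ e)^-1 :> R.
  by rewrite -[N%:R^-1]powR_inv1 ?(ltW N0)// -powRrM mulN1r powRN.
rewrite powRM ?invr_ge0 ?(ltW N0)// Ne ler_wpM2r ?invr_ge0 ?powR_ge0//.
by apply: powR_le_self => //; lra.
Qed.

Lemma normc_if (b : bool) (a : R) :
  normc (if b then a%:C%C else 0) = if b then `|a| else 0.
Proof. by case: b; [exact: normc_real|exact: normc0]. Qed.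

Lemma delta_lower (r : R) (p1 : (1 <= r%:E)%E) N M : (408 <= N)%N -> r <= 2 -> (12 * N <= M)%N ->
  N%:R `^ (r^-1 - 2^-1) / (20 * spread R) <= nr (partial_h N M (delta p1 0)).
Proof.
move=> N4 r2 NM; have N0 : 0 < N%:R :> R by rewrite ltr0n (leq_trans _ N4).
have r1 : 1 <= r by []. have r0 : 0 < r := lt_le_trans ltr01 r1.
have s1 := spread_ge1 R; have s0 : 0 < spread R := lt_le_trans ltr01 s1.
set B := (spread R / N%:R) `^ 2^-1; have B0 : 0 < B by rewrite powR_gt0// divr_gt0.
have ri : 2^-1 <= r^-1 by rewrite lef_pV2 ?posrE.
have ri1 : r^-1 <= 1 by rewrite invf_le1.
set y := partial_h _ _ _.
have key : 1 `^ r <= 20 * B `^ (2 - r) * nr y `^ r.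
  have yr : \sum_(i < 12 * N | window N i) `|h N i| `^ r <= nr y `^ r.
    rewrite /y partial_h_delta nr_delta_comb_powR; last by move=> a b [].
    under [leRHS]eq_bigr do rewrite normc_real.
    rewrite -(subnKC NM) [leRHS]big_split_ord /=. apply: ler_wpDr; first by apply: sumr_ge0 => i _; exact: powR_ge0.
    by rewrite [leRHS](bigID (fun i : 'I_(12 * N) => window N i)) /= lerDl sumr_ge0// => *; exact: powR_ge0.
  have mass := h_mass R (leq_trans (isT : 20 <= 408)%N N4).
  have H : \sum_(i < 12 * N | window N i) h N i ^+ 2 <=
      B `^ (2 - r) * \sum_(i < 12 * N | window N i) `|h N i| `^ r.
    rewrite mulr_sumr; apply: ler_sum => i iw; rewrite -(real_normK (num_real (h N i))).
    have [+ _] := powR_split (normr_ge0 (h N i)) B0 (h_window_abs N4 iw) r0.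
    by rewrite mulrC; apply.
  have H2 := ler_wpM2l (powR_ge0 B (2 - r)) yr.
  rewrite powR1; have := le_trans mass (le_trans H H2); rewrite -mulrA.
  move: (_ * nr y `^ r) => u; lra.
have K0 : 0 <= 20 * B `^ (2 - r) by rewrite mulr_ge0 ?powR_ge0 ?ler0n.
have := le_powR_root r0 K0 ler01 (nr_ge0 y) key.
rewrite powRM ?powR_ge0 ?ler0n// /B -!powRrM.
have -> : 2^-1 * ((2 - r) / r) = r^-1 - 2^-1 by field; rewrite gt_eqF.
set e := r^-1 - 2^-1 => H.
have h20 : 20 `^ r^-1 <= 20 :> R by rewrite powR_le_self// ler1n.
have eA : (spread R / N%:R) `^ e <= spread R / N%:R `^ e by apply: root_spread_le => //; rewrite /e; lra.
have Ne : 0 < N%:R `^ e by exact: powR_gt0.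
have : 1 <= 20 * (spread R / N%:R `^ e) * nr y.
  apply: (le_trans H); rewrite ler_wpM2r ?nr_ge0//.
  by apply: ler_pM; rewrite ?powR_ge0.
rewrite (ler_pdivrMr _ _ (mulr_gt0 (ltr0Sn _ _) s0)) => /(ler_wpM2l (ltW Ne)); rewrite mulr1 => /le_trans; apply.
by rewrite le_eqVlt; apply/orP; left; apply/eqP; field; rewrite gt_eqF.
Qed.

Lemma window_test_upper_fin (r : R) (p1 : (1 <= r%:E)%E) N : (408 <= N)%N -> 2 <= r ->
  nr (window_test p1 N) <= 2 * spread R / N%:R `^ (2^-1 - r^-1).
Proof.
move=> N4 r2; have N0 : 0 < N%:R :> R by rewrite ltr0n (leq_trans _ N4).
have r1 : 1 <= r by []. have r0 : 0 < r := lt_le_trans ltr01 r1.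
have s1 := spread_ge1 R; have s0 : 0 < spread R := lt_le_trans ltr01 s1.
set B := (spread R / N%:R) `^ 2^-1; have B0 : 0 < B by rewrite powR_gt0// divr_gt0.
have ri : r^-1 <= 2^-1 by rewrite lef_pV2 ?posrE.
have ri1 : r^-1 <= 1 by rewrite invf_le1.
have ri0 : 0 < r^-1 by rewrite invr_gt0.
have key : nr (window_test p1 N) `^ r <= 2 * B `^ (r - 2) * 1 `^ r.
  rewrite /window_test nr_delta_comb_powR; last by move=> a b /oppr_inj [].
  have -> : \sum_(i < 12 * N) normc (if window N i then (h N i)%:C%C else 0) `^ r =
      \sum_(i < 12 * N | window N i) `|h N i| `^ r.
    rewrite [RHS]big_mkcond; apply: eq_bigr => i _; rewrite normc_if.
    by case: ifP => // _; rewrite powR0 ?gt_eqF.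
  apply: (@le_trans _ _ (\sum_(i < 12 * N | window N i) h N i ^+ 2 * B `^ (r - 2))).
    apply: ler_sum => i iw; rewrite -(real_normK (num_real (h N i))).
    have [_] := powR_split (normr_ge0 (h N i)) B0 (h_window_abs N4 iw) r0.
    by apply.
  rewrite -mulr_suml powR1 mulr1 ler_wpM2r ?powR_ge0//.
  apply: (@le_trans _ _ (\sum_(i < 12 * N) h N i ^+ 2)).
    by rewrite [leRHS](bigID (fun i : 'I_(12 * N) => window N i)) /= lerDl sumr_ge0// => *; exact: sqr_ge0.
  apply: (le_trans (sum_h_sq_le _ _ _)); lra.
have K0 : 0 <= 2 * B `^ (r - 2) by rewrite mulr_ge0 ?powR_ge0.
have := le_powR_root r0 K0 (nr_ge0 _) ler01 key.
rewrite mulr1 powRM ?powR_ge0// /B -!powRrM.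
have -> : 2^-1 * ((r - 2) / r) = 2^-1 - r^-1 by field; rewrite gt_eqF.
move=> /le_trans; apply; rewrite -mulrA ler_pM ?powR_ge0//.
  by rewrite powR_le_self// ler1n.
by apply: root_spread_le => //; lra.
Qed.

Lemma window_test_upper_infty (p1 : (1 <= +oo :> \bar R)%E) N : (408 <= N)%N ->
  nr (window_test p1 N) <= 2 * spread R / N%:R `^ `|2^-1|.
Proof.
move=> N4; have N0 : 0 < N%:R :> R by rewrite ltr0n (leq_trans _ N4).
have s1 := spread_ge1 R; have s0 : 0 < spread R := lt_le_trans ltr01 s1.
rewrite ger0_norm ?invr_ge0//; apply: (@le_trans _ _ ((spread R / N%:R) `^ 2^-1)).
  rewrite -lee_fin -nrE ellnorm_infty; apply: ge_ereal_sup => _ [k _ <-]; rewrite lee_fin.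
  apply: delta_comb_normc_le => [a b /oppr_inj []||i _]//; first exact: powR_ge0.
  by rewrite normc_if; case: ifP => iw; [exact: h_window_abs|exact: powR_ge0].
apply: (@le_trans _ _ (spread R / N%:R `^ 2^-1)); first by apply: root_spread_le => //; lra.
rewrite ler_wpM2r ?invr_ge0 ?powR_ge0//; lra.
Qed.

End lower_exponent.

Lemma delta_nr_gt0 (R : realType) (p : \bar R) (p1 : (1 <= p)%E) : 0 < nr (delta p1 0).
Proof. by apply: lt_le_trans (normc_le_nr _ 0); rewrite deltaE eqxx normc1. Qed.

Lemma delta_nr_le1 (R : realType) (r : R) (p1 : (1 <= r%:E)%E) : nr (delta p1 0) <= 1.
Proof.
have r0 : 0 < r := lt_le_trans ltr01 (p1 : 1 <= r).
have inj : injective Posz by move=> a b [].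
have := nr_delta_comb_powR p1 (fun=> 1) 1 inj.
rewrite /delta_comb !big_ord1 scale1r normc1 powR1 => H.
have H' : nr (delta p1 0) `^ r = 1 := H.
have : (nr (delta p1 0) `^ r) `^ r^-1 = 1 by rewrite H' powR1.
by rewrite -powRrM mulfV ?lt0r_neq0// powRr1 ?nr_ge0// => ->.
Qed.

(** In (1 - S/2) V = S - 1/2, with S the shift, the factor 1 - S/2 has norm at most 3/2 and the
    right side shrinks norms at most by 1/2. The exponential bound that follows settles the finitely
    many N < 408. *)
Lemma blaschke_lower_step (R : realType) (p : \bar R) (p1 : (1 <= p)%E) (x : ell R p1) :
  nr x / 3 <= nr (blaschke p1 x).
Proof.
have e : comp_half (blaschke p1 x) = shift x - (2^-1 : R)%:C%C *: x.
  apply: ell_ext => k; rewrite /comp_half !(ellN, ell_valD, ell_valZ, shiftE).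
  by rewrite (blaschkeE x k); ring.
have := nr_comp_half_le (blaschke p1 x); rewrite e.
have := nrD (shift x - (2^-1 : R)%:C%C *: x) ((2^-1 : R)%:C%C *: x).
rewrite subrK nr_shift nrZ normc_real ger0_norm ?invr_ge0//; lra.
Qed.

Lemma blaschke_iter_lower_exp (R : realType) (p : \bar R) (p1 : (1 <= p)%E) N (x : ell R p1) :
  nr x / 3 ^+ N <= nr (iter N (blaschke p1) x).
Proof.
elim: N => [|N IH]; first by rewrite expr0 divr1.
rewrite iterS exprSr invfM mulrA (le_trans _ (blaschke_lower_step _))//.
by rewrite ler_wpM2r ?invr_ge0.
Qed.

(** 80 = 2 20 2: the test vector has norm at most 2 [spread R] / N^e, its image under [partial_h]
    has norm at least 1/20, and [comp_half] costs a factor 2. *)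
Lemma blaschke_iter_lower (R : realType) (p : \bar R) (p1 : (1 <= p)%E) N : (408 <= N)%N ->
  exists2 x : ell R p1, 0 < nr x &
    N%:R `^ `|2^-1 - fine p^-1| / (80 * spread R) * nr x <= nr (iter N (blaschke p1) x).
Proof.
move=> N4; have N0 : 0 < N%:R :> R by rewrite ltr0n (leq_trans _ N4).
have s1 := spread_ge1 R; have s0 : 0 < spread R := lt_le_trans ltr01 s1.
have Npos e : 0 < N%:R `^ e :> R by exact: powR_gt0.
have testP (e : R) : nr (window_test p1 N) <= 2 * spread R / N%:R `^ e ->
  exists2 x : ell R p1, 0 < nr x &
    N%:R `^ e / (80 * spread R) * nr x <= nr (iter N (blaschke p1) x).
  move=> H; exists (window_test p1 N).
    rewrite lt_def nr_ge0 andbT; apply/eqP => z.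
    have := partial_h_window_test p1 (leq_trans (isT : 20 <= 408)%N N4) (leqnn _).
    have -> : window_test p1 N = 0 by apply: ell_norm_eq0; rewrite /ell_norm -/(nr _) z.
    have -> : partial_h N (12 * N) (0 : ell R p1) = 0.
      by apply: ell_ext => k; rewrite partial_hE big1// => i _; rewrite mulr0.
    by rewrite nr0; lra.
  have := blaschke_iter_ge (fun M => @partial_h_window_test R p p1 N M (leq_trans (isT : 20 <= 408)%N N4)).
  apply: le_trans.
  have k0 : 0 <= N%:R `^ e / (80 * spread R) by exact: divr_ge0 (ltW (Npos _)) (mulr_ge0 (ler0n _ _) (ltW s0)).
  apply: (le_trans (ler_wpM2l k0 H)).
  rewrite le_eqVlt; apply/orP; left; apply/eqP; field.
  by rewrite !gt_eqF.
case: p p1 testP => [r r1|r1|//] testP; last first.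
  by rewrite invey subr0; apply: testP; exact: window_test_upper_infty.
have r1' : 1 <= r by []. have r0 : 0 < r := lt_le_trans ltr01 r1'.
rewrite inver gt_eqF//=.
have [r2|r2] := leP 2 r.
  have ri : r^-1 <= 2^-1 by rewrite lef_pV2 ?posrE.
  by rewrite ger0_norm ?subr_ge0//; apply: testP; exact: window_test_upper_fin.
have ri : 2^-1 <= r^-1 by rewrite lef_pV2 ?posrE// ltW.
exists (delta r1 0); first exact: delta_nr_gt0.
rewrite distrC ger0_norm ?subr_ge0//.
have := blaschke_iter_ge (fun M => @delta_lower R r r1 N M N4 (ltW r2)).
apply: le_trans; set e := r^-1 - 2^-1.
have k0 : 0 <= N%:R `^ e / (80 * spread R) by exact: divr_ge0 (ltW (Npos _)) (mulr_ge0 (ler0n _ _) (ltW s0)).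
apply: (le_trans (ler_piMr k0 (delta_nr_le1 r1))).
have -> : N%:R `^ e / (80 * spread R) = N%:R `^ e / (20 * spread R) / 4.
  by field; rewrite gt_eqF.
have : 0 <= N%:R `^ e / (20 * spread R) by exact: divr_ge0 (ltW (Npos _)) (mulr_ge0 (ler0n _ _) (ltW s0)).
move: (_ / (20 * _)) => u; lra.
Qed.

(* The two-sided estimate with a single constant *)
Local Close Scope classical_set_scope.

(** One summand each for the upper bound, the lower bound with N >= 408, and the lower bound with N
    < 408, where N^e 3^N <= 408 3^408 as e <= 1. *)
Definition growth_const (R : realType) : R := 1000 + 80 * spread R + 408 * 3 ^+ 408.

Lemma growth_constP (R : realType) : [/\ 1000 <= growth_const R,
  80 * spread R <= growth_const R & 408 * 3 ^+ 408 <= growth_const R].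
Proof.
have gen (a b c : R) : 0 <= a -> 0 <= b -> 0 <= c ->
  [/\ a <= a + b + c, b <= a + b + c & c <= a + b + c] by move=> *; split; lra.
apply: gen; first exact: ler0n.
  exact: mulr_ge0 (ler0n _ _) (le_trans ler01 (spread_ge1 R)).
exact: mulr_ge0 (ler0n _ _) (exprn_ge0 _ (ler0n _ _)).
Qed.

Lemma exponent_le1 (R : realType) (p : \bar R) : (1 <= p)%E -> `|2^-1 - fine p^-1| <= 1.
Proof.
case: p => [r r1|_|//]; last by rewrite invey subr0 ger0_norm ?invr_ge0// invf_le1 ?ler1n.
have r1' : 1 <= r by []. have r0 : 0 < r := lt_le_trans ltr01 r1'.
rewrite inver gt_eqF//=; have : r^-1 <= 1 by rewrite invf_le1.
have : 0 < r^-1 by rewrite invr_gt0.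
by rewrite ler_norml; move: (r^-1) => u; lra.
Qed.

Lemma opnorm_iter_blaschke_ge (R : realType) (p : \bar R) (p1 : (1 <= p)%E) N :
  (1 <= N)%N ->
  (((growth_const R)^-1 * N%:R `^ `|2^-1 - fine p^-1|)%:E
    <= opnorm (iter N (blaschke p1)))%E.
Proof.
move=> N1; have [k1 k2 k3] := growth_constP R; move: k1 k2 k3.
set e := `|_|; move: (growth_const R) => K k1 k2 k3.
have s0 : 0 < 80 * spread R.
  exact: mulr_gt0 (ltr0Sn _ _) (lt_le_trans ltr01 (spread_ge1 R)).
have K0 : 0 < K := lt_le_trans s0 k2.
have lin a x : iter N (blaschke p1) (a *: x) = a *: iter N (blaschke p1) x.
  by elim: (N) => [//|n IH]; rewrite !iterS IH linearZ.
have Ne0 : 0 <= N%:R `^ e by exact: powR_ge0.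
suff [x x0 H] : exists2 x : ell R p1, 0 < nr x &
    K^-1 * N%:R `^ e * nr x <= nr (iter N (blaschke p1) x).
  by apply: le_trans (opnorm_ge x0 lin); rewrite lee_fin ler_pdivlMr.
have [N4|N4] := leqP 408 N.
  have [x x0 H] := blaschke_iter_lower p1 N4; exists x => //; apply: le_trans H.
  rewrite ler_wpM2r ?(ltW x0)// -/e mulrC ler_wpM2l//.
  by rewrite lef_pV2 ?posrE.
exists (delta p1 0); first exact: delta_nr_gt0.
apply: le_trans (blaschke_iter_lower_exp N _).
rewrite [leRHS]mulrC ler_wpM2r ?nr_ge0// mulrC ler_pdivrMr// ler_pdivlMl; last first.
  by apply: exprn_gt0; exact: ltr0Sn.
apply: le_trans k3; rewrite mulrC; apply: ler_pM => //.
  apply: (@le_trans _ _ N%:R); last by rewrite ler_nat ltnW.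
  by rewrite powR_le_self ?ler1n ?exponent_le1.
apply: ler_weXn2l; first by rewrite ler1n.
exact: ltnW.
Qed.

Theorem proposition1p2 (R : realType) :
  exists (V : {linear ell_infty R -> ell_infty R}) (C : R),
    bounded_operator V /\ 1 <= C /\
    forall (p : \bar R) (p1 : (1 <= p)%E),
      exists W : {linear ell R p1 -> ell R p1},
        [/\ is_restriction V W, bounded_operator W, strongly_kreiss_bounded W &
          forall N : nat, (1 <= N)%N ->
            ((C^-1 * N%:R `^ `|2^-1 - fine p^-1|)%:E <= opnorm (iter N W))%E /\
            (opnorm (iter N W) <= (C * N%:R `^ `|2^-1 - fine p^-1|)%:E)%E].
Proof.
have [k1 _ _] := growth_constP R.
exists (@blaschke R +oo%E (leey 1)), (growth_const R).
split; first exact: blaschke_bounded.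
split; first by apply: le_trans k1; rewrite ler1n.
move=> p p1; exists (blaschke p1); split.
- exact: blaschke_restriction.
- exact: blaschke_bounded.
- exact: blaschke_strongly_kreiss.
- move=> N N1; split; first exact: opnorm_iter_blaschke_ge.
  apply: opnorm_le.
    exact: mulr_ge0 (le_trans (ler0n _ _) k1) (powR_ge0 _ _).
  move=> x; apply: (le_trans (blaschke_iter_upper x N1)).
  by rewrite ler_wpM2r ?nr_ge0// ler_wpM2r ?powR_ge0.
Qed.
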